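(* Let $\mathcal{H}=\{H_e:e\in E\}$ be a central hyperplane arrangement in the $n$-dimensional real inner product space $V$ with base chamber $T_0$, and let $f:V\to\mathbb{C}$ be integrable; for $b\in V$ write $f_b(x)=f(x-b)$. (i) For every chamber $T$ of $\mathcal{H}$ and every $a\in V$, $$\int_T f_a\,dV-\int_T f\,dV=\sum_U(-1)^T(-1)^{U\circ e_U}(a,e_U)\int_0^1\Big(\int_U f_{ta}(y)\,dV_{H_{e_U}}(y)\Big)dt,$$ where the sum runs over all facets $U$ of $T$ (faces of $\mathcal{H}$ of dimension $n-1$ contained in the closure of $T$) and $e_U$ is the unique element of $E$ with $U\subseteq H_{e_U}$. (ii) For each $e\in E$ choose arbitrarily a base chamber $Z_0(e)$ of the even restricted arrangement $\mathcal{H}_e$. Then for every $a\in V$, $$P(\mathcal{H},f_a)-P(\mathcal{H},f)=2\sum_{e\in E}(-1)^{Z_0(e)\circ e}\,(a,e)\int_0^1P\big(\mathcal{H}_e,f_{ta}|_{H_e}\big)\,dt,$$ where $P(\mathcal{H}_e,\cdot)$ is computed in $H_e$ with respect to the base chamber $Z_0(e)$.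
   Context: $V$ has inner product $(\cdot,\cdot)$; $\mathcal{H}$ is given by a finite set $E$ of unit vectors, no two linearly dependent, $H_e=\{x:(e,x)=0\}$; the base chamber $T_0$ satisfies $(e,x)>0$ on $T_0$ for all $e\in E$. For an arrangement $\mathcal{A}$ of linear hyperplanes in an inner product space $X$ with chosen base chamber $Z_0$, the sign of a chamber $Z$ is $(-1)^Z=(-1)^s$, $s$ the number of hyperplanes of $\mathcal{A}$ separating $Z$ and $Z_0$, and $P(\mathcal{A},g)=\sum_Z(-1)^Z\int_Z g\,dV_X$ ($dV_X$ Lebesgue measure of $X$). An (open) face of $\mathcal{H}$ is a nonempty set $\bigcap_{e\in E_0}H_e\cap\bigcap_{e\in E_+}\{(e,x)>0\}\cap\bigcap_{e\in E_-}\{(e,x)<0\}$ for a partition $E=E_0\sqcup E_+\sqcup E_-$. For a face $F$ and a vector $v$, $F\circ v$ is the face $G$ such that $x+\varepsilon v\in G$ for all $x\in F$ and all sufficiently small $\varepsilon>0$; when $F\circ v$ is a chamber, $(-1)^{F\circ v}$ is its sign. For $e\in E$: the intersection multiplicity of a codimension-2 subspace $V'$ is $\#\{f\in E:H_f\supseteq V'\}$; the restricted arrangement is $\mathcal{H}''_e=\{H_e\cap H_f:f\in E,f\neq e\}$ in $H_e$, and the even restricted arrangement is $\mathcal{H}_e=\{H_e\cap H_f: f\in E, f\neq e, \text{the intersection multiplicity of }H_e\cap H_f\text{ is even}\}$, an arrangement of hyperplanes in $H_e$. For a chamber $Z$ of $\mathcal{H}_e$, $(-1)^{Z\circ e}$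 is defined as $(-1)^{U\circ e}$ for any chamber $U$ of $\mathcal{H}''_e$ contained in $Z$ ($U$ is a face of $\mathcal{H}$ and $U\circ e$ a chamber of $\mathcal{H}$); this does not depend on the choice of $U$. *)

(* Defs.v *)
From HB Require Import structures.
From mathcomp Require Import all_boot all_order all_algebra finmap.
From mathcomp Require Import sesquilinear complex.
From mathcomp Require Import all_classical all_reals all_analysis.
From mathcomp Require Import ring lra.

Set Implicit Arguments.
Unset Strict Implicit.
Unset Printing Implicit Defensive.

Import Order.TTheory GRing.Theory Num.Theory.
Import numFieldNormedType.Exports.

Local Open Scope classical_set_scope.
Local Open Scope ring_scope.

Section EuclideanNorm.
Context {R : realType} {V : vectType R}.
Implicit Types (dot : {dot V for idfun}) (u v : V).

Lemma dotC dot u v : dot u v = dot v u.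
Proof. by rewrite (hermC dot) expr0 mul1r. Qed.

Lemma dot_ge0 dot u : 0 <= dot u u.
Proof.
have [->|u0] := eqVneq u 0; first by rewrite linear0l.
by apply/ltW/neq0_dnorm_gt0.
Qed.

Lemma dotDD dot u v : dot (u + v) (u + v) = dot u u + dot u v *+ 2 + dot v v.
Proof. by rewrite linearDl/= !linearDr/= (dotC dot v u); ring. Qed.

Lemma dotZl dot (a : R) u v : dot (a *: u) v = a * dot u v.
Proof. by rewrite linearZl_LR. Qed.

Lemma dotZr dot (a : R) u v : dot u (a *: v) = a * dot u v.
Proof. by rewrite dotC dotZl dotC. Qed.

Lemma dotZZ dot (a : R) u : dot (a *: u) (a *: u) = a ^+ 2 * dot u u.
Proof. by rewrite dotZl dotZr mulrA. Qed.

Lemma dot_cauchy_schwarz dot u v : dot u v ^+ 2 <= dot u u * dot v v.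
Proof.
have [->|v0] := eqVneq v 0; first by
  rewrite [dot u 0]linear0r [dot 0 0]linear0r expr0n mulr0.
have vv : 0 < dot v v by exact: neq0_dnorm_gt0.
have := dot_ge0 dot (dot v v *: u + (- dot u v) *: v).
rewrite dotDD !dotZZ dotZl dotZr.
rewrite (_ : _ + _ = dot v v * (dot u u * dot v v - dot u v ^+ 2)); last by ring.
by rewrite pmulr_rge0// subr_ge0.
Qed.

(* V with the norm of the inner product, hence with its usual topology. *)
Definition euclidean dot : Type := V.

HB.instance Definition _ dot := Vector.on (euclidean dot).

Definition enorm dot u : R := Num.sqrt (dot u u).

Let ler_enormD dot u v : enorm dot (u + v) <= enorm dot u + enorm dot v.
Proof.
rewrite -(@ler_pXn2r _ 2)// ?nnegrE ?addr_ge0 ?sqrtr_ge0//.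
rewrite sqrrD !sqr_sqrtr ?dot_ge0// dotDD lerD2r lerD2l ler_wMn2r//.
apply: (le_trans (ler_norm _)); rewrite -sqrtrM ?dot_ge0// -sqrtr_sqr.
exact/ler_wsqrtr/dot_cauchy_schwarz.
Qed.

Let enormZ dot (a : R) u : enorm dot (a *: u) = `|a| * enorm dot u.
Proof. by rewrite /enorm dotZZ sqrtrM ?sqr_ge0// sqrtr_sqr. Qed.

Let enorm0_eq0 dot u : enorm dot u = 0 -> u = 0.
Proof.
move=> /eqP; rewrite sqrtr_eq0 => u0; apply/eqP/negPn/negP => /neq0_dnorm_gt0.
by move=> /(_ _ dot); rewrite ltNge u0.
Qed.

HB.instance Definition _ dot := Lmodule_isNormed.Build R (euclidean dot)
  (@ler_enormD dot) (@enormZ dot) (@enorm0_eq0 dot).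

End EuclideanNorm.

Section LebesgueTuple.
Context {R : realType}.
Local Notation Rm := (measurableTypeR R).
Local Open Scope ereal_scope.

Definition tcons n (p : Rm * n.-tuple Rm) : n.+1.-tuple Rm :=
  [tuple of p.1 :: p.2].

Definition tuncons n (t : n.+1.-tuple Rm) : Rm * n.-tuple Rm :=
  (thead t, [tuple of behead t]).

Lemma tconsK n : cancel (@tcons n) (@tuncons n).
Proof. by case=> x t; congr pair; apply/val_inj. Qed.

Lemma tunconsK n : cancel (@tuncons n) (@tcons n).
Proof. by move=> t; rewrite [RHS]tuple_eta; apply/val_inj. Qed.

Lemma measurable_tcons n : measurable_fun setT (@tcons n).
Proof. by apply: measurable_cons. Qed.

Lemma measurable_tuncons n : measurable_fun setT (@tuncons n).
Proof.
apply: measurable_fun_pair; last exact: measurable_behead.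
exact: measurable_tnth.
Qed.

Section Step.
Variables (n : nat) (mu : {sigma_finite_measure set (n.-tuple Rm) -> \bar R}).

Definition lebesgue_tcons : set (n.+1.-tuple Rm) -> \bar R :=
  pushforward (lebesgue_measure \x mu) (@tcons n).

Let nu : {measure set (n.+1.-tuple Rm) -> \bar R} :=
  measure_function_pushforward__canonical__measure_function_Measure
    (lebesgue_measure \x mu) (@measurable_tcons n).

Let lebesgue_tcons0 : lebesgue_tcons set0 = 0.
Proof. exact: (measure0 nu). Qed.

Let lebesgue_tcons_ge0 A : 0 <= lebesgue_tcons A.
Proof. exact: (measure_ge0 nu). Qed.

Let lebesgue_tcons_additive : semi_sigma_additive lebesgue_tcons.
Proof. exact: (@measure_semi_sigma_additive _ _ _ nu). Qed.

HB.instance Definition _ := isMeasure.Build _ _ _ lebesgue_tcons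
  lebesgue_tcons0 lebesgue_tcons_ge0 lebesgue_tcons_additive.

Let lebesgue_tcons_sigma_finite : sigma_finite setT lebesgue_tcons.
Proof.
have /sigma_finiteP[F [FT ndF mF]] := sigma_finiteT (@lebesgue_measure R).
have /sigma_finiteP[G [GT ndG mG]] := sigma_finiteT mu.
exists (fun i => @tuncons n @^-1` (F i `*` G i)).
  rewrite -preimage_bigcup; apply/esym/seteqP; split=> // t _.
  have [k1 _ Fk1] : (\bigcup_k F k) (tuncons t).1 by rewrite -FT.
  have [k2 _ Gk2] : (\bigcup_k G k) (tuncons t).2 by rewrite -GT.
  exists (maxn k1 k2) => //; split.
    by move: Fk1; exact/subsetPset/ndF/leq_maxl.
  by move: Gk2; exact/subsetPset/ndG/leq_maxr.
move=> i; have [mFi Fi] := mF i; have [mGi Gi] := mG i; split.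
  rewrite -[X in measurable X]setTI.
  by apply: measurable_tuncons => //; exact: measurableX.
rewrite /lebesgue_tcons /pushforward -comp_preimage.
rewrite (_ : _ \o _ = id) ?preimage_id; last exact/funext/tconsK.
by rewrite product_measure1E// lte_mul_pinfty// ge0_fin_numE.
Qed.

HB.instance Definition _ := Measure_isSigmaFinite.Build _ _ _ lebesgue_tcons
  lebesgue_tcons_sigma_finite.

End Step.

(* n-dimensional Lebesgue measure, on the Borel sets of R^n. *)
Fixpoint lebesgue_tuple n : {sigma_finite_measure set (n.-tuple Rm) -> \bar R} :=
  match n with
  | 0 => dirac [tuple]
  | m.+1 => lebesgue_tcons (lebesgue_tuple m)
  end.

End LebesgueTuple.

Section ComplexIntegral.
Context d {T : measurableType d} {R : realType}.
Implicit Types (mu : {measure set T -> \bar R}) (D : set T) (f : T -> R[i]).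

Definition cintegrable mu D f : Prop :=
  mu.-integrable D (EFin \o (@complex.Re R \o f)) /\
  mu.-integrable D (EFin \o (@complex.Im R \o f)).

Definition cintegral mu D f : R[i] :=
  Complex (\int[mu]_(x in D) complex.Re (f x)) (\int[mu]_(x in D) complex.Im (f x)).

End ComplexIntegral.

Section SubspaceIntegral.
Context {R : realType} {V : vectType R}.
Variable dot : {dot V for idfun}.
Implicit Types (X : {vspace V}) (A : set V) (f : V -> R[i]) (a b : V).

(* Some orthonormal basis of X; the junk value vbasis X is never reached, by
   Gram-Schmidt. By rotation invariance of lebesgue_tuple, nothing below depends
   on the choice. *)
Definition onbasis X : (\dim X).-tuple V :=
  xget (vbasis X) [set b | basis_of X b /\ orthonormal dot b].

Definition of_coord X (c : (\dim X).-tuple (measurableTypeR R)) : V :=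
  \sum_(i < \dim X) (tnth c i : R) *: tnth (onbasis X) i.

(* Integral over A (a subset of X) for the Lebesgue measure of X, that is the
   image of lebesgue_tuple under orthonormal coordinates. The library integral
   is a supremum over Borel simple functions below the (positive and negative
   parts of the) integrand, so it also gives the right value on integrands that
   are Lebesgue but not Borel measurable. *)
Definition subspace_integral X A f : R[i] :=
  cintegral (lebesgue_tuple (\dim X)) (@of_coord X @^-1` A) (f \o @of_coord X).

(* Lebesgue integrability on V: as lebesgue_tuple lives on Borel sets, a Lebesgue
   integrable function is one that is a.e. equal to a Borel integrable one. *)
Definition lebesgue_integrable f : Prop :=
  exists2 g, cintegrable (lebesgue_tuple (\dim {:V})) setT g &
    {ae lebesgue_tuple (\dim {:V}), forall c, f (of_coord c) = g c}.

Definition translate f b : V -> R[i] := fun x => f (x - b).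

End SubspaceIntegral.

Section Arrangement.
Context {R : realType} {V : vectType R}.
Variable dot : {dot V for idfun}.
Implicit Types (X H : {vspace V}) (AA : {fset {vspace V}}) (Z : set V).

(* In this section AA is an arrangement of hyperplanes of the subspace X. *)
Definition arrangement_compl X AA : set (euclidean dot) :=
  [set x : V | x \in X /\ forall H, H \in AA -> x \notin H].

Definition chambers X AA : set (set V) :=
  [set connected_component (arrangement_compl X AA) x
     | x in arrangement_compl X AA].

Definition separates X H Z Z' : Prop :=
  forall x y, Z x -> Z' y ->
    ~ connected_component (arrangement_compl X [fset H]%fset) x y.

Definition chamber_sign X AA Z0 Z : R[i] :=
  (-1) ^+ #|` [fset H in AA | `[< separates X H Z0 Z >]]%fset |.

Definition alt_integral X AA Z0 (g : V -> R[i]) : R[i] :=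
  \sum_(Z \in chambers X AA)
    chamber_sign X AA Z0 Z * subspace_integral dot X Z g.

End Arrangement.

Section CentralArrangement.
Context {R : realType} {V : vectType R}.
Variables (dot : {dot V for idfun}) (E : {fset V}).
Implicit Types (e v x : V) (F G T U Z : set V).

Definition hyperplane e : {vspace V} := orthov dot <[e]>.

Definition arrangement : {fset {vspace V}} := [fset hyperplane e | e in E]%fset.

Definition faces : set (set V) :=
  [set F | F !=set0 /\ exists E0 Ep En : {fset V},
    [/\ (E0 `|` Ep `|` En = E)%fset,
        [/\ [disjoint E0 & Ep]%fset, [disjoint E0 & En]%fset
          & [disjoint Ep & En]%fset] &
        F = [set x | [/\ forall e, e \in E0 -> dot e x = 0,
                         forall e, e \in Ep -> 0 < dot e x &
                         forall e, e \in En -> dot e x < 0]]]].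

(* F o v; the face is unique and exists for every face F. *)
Definition face_comp F v : set V :=
  xget set0 [set G | faces G /\
    forall x, F x -> \forall eps \near (0 : R)^'+, G (x + eps *: v)].

(* The dimension of F is that of its linear span W. *)
Definition has_dim F (d : nat) : Prop :=
  exists W : {vspace V}, [/\ forall x, F x -> x \in W,
    forall W' : {vspace V}, (forall x, F x -> x \in W') -> (W <= W')%VS &
    \dim W = d].

Definition facets T : set (set V) :=
  [set U | [/\ faces U, exists2 d, d.+1 = \dim {:V} & has_dim U d &
    U `<=` closure (T : set (euclidean dot))]].

Definition facet_normal U : V :=
  xget 0 [set e | e \in E /\ forall x, U x -> x \in hyperplane e].

Definition multiplicity (W : {vspace V}) : nat :=
  #|` [fset f in E | (W <= hyperplane f)%VS]%fset |.

Definition restricted e : {fset {vspace V}} :=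
  [fset (hyperplane e :&: hyperplane f)%VS | f in E & f != e]%fset.

Definition even_restricted e : {fset {vspace V}} :=
  [fset (hyperplane e :&: hyperplane f)%VS | f in E &
    (f != e) && ~~ odd (multiplicity (hyperplane e :&: hyperplane f))]%fset.

Definition base_sign (T0 T : set V) : R[i] :=
  chamber_sign dot fullv arrangement T0 T.

(* (-1)^(Z o e), computed from some chamber U of the restricted arrangement
   contained in Z; the value does not depend on U. *)
Definition restricted_sign (T0 : set V) e Z : R[i] :=
  base_sign T0 (face_comp
    (xget set0 [set U | chambers dot (hyperplane e) (restricted e) U /\ U `<=` Z])
    e).

End CentralArrangement.

(* Main.v *)
(** Shifting f by a is the same as shifting the domain of integration by -a, so
    both parts compare the integral of f against phi(x + a) and against phi(x),
    where phi is a product over e in E of functions of the sign of (e, x): the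
    indicator of T for (i), the sign of the chamber containing x for (ii). For
    almost every x the path x + t a, 0 <= t <= 1, meets the hyperplanes one at
    a time, so phi(x + a) - phi(x) telescopes into one jump per hyperplane that
    is crossed. The substitution x = y - t a with y in H_e, of Jacobian
    |(a, e)|, turns the integral of the jumps at H_e into an iterated integral.
    The change of variables rests on the rotation invariance of
    lebesgue_tuple, which follows from the uniqueness of translation invariant
    measures. In (ii) the jump at a point of H_e is, up to the factor 2, the
    product of the signs of the other (f, y); grouping these by H_e /\ H_f, only
    the subspaces of even multiplicity survive. *)
From HB Require Import structures.
Require Import Defs.
From mathcomp Require Import all_boot all_order all_algebra finmap.
From mathcomp Require Import sesquilinear complex.
From mathcomp Require Import all_classical all_reals all_analysis.
From mathcomp Require Import measurable_realfun ring lra.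
Set Implicit Arguments.
Unset Strict Implicit.
Unset Printing Implicit Defensive.
Import Order.TTheory GRing.Theory Num.Theory.
Import numFieldNormedType.Exports.
Local Open Scope classical_set_scope.
Local Open Scope ring_scope.

(** * Translation and scaling of Lebesgue measure; uniqueness of translation invariant measures on
    R^n *)

Section MeasureInvariance.
Context {R : realType}.
Local Notation Rm := (measurableTypeR R).
Local Notation leb := (@lebesgue_measure R).
Local Open Scope ereal_scope.

(** One identity, [stepprod_flux], serves both parts. A [stepprod] takes for each e its own values
    [p e] and [q e] on the two sides of H_e, and the jump at H_e enters with weight (p e - q e)(a,
    e). In (i) p e - q e is the sign of (e, x) for x in T, which equals (-1)^T (-1)^(U o e); in (ii)
    it is 2. The obstacle is that f is only almost everywhere equal to a Borel integrable F on V,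
    whereas every H_e is a null set, so that on a given slice H_e - t a the function f may be
    unrelated to F. If (a, e) is nonzero, a null set of V meets almost every slice in a null set, so
    f can be replaced by F under the integral over t. If (a, e) = 0, the slices do not move, and
    only the factor (a, e) makes the term vanish. For the same reason integrals of arbitrary
    functions are compared off null sets. The statement speaks of connected components, partitions
    of E, spans and closures; all of these are first translated into sign vectors on E, where the
    products live. *)

Lemma measurable_preimage d1 d2 (T1 : measurableType d1) (T2 : measurableType d2)
    (f : T1 -> T2) A : measurable_fun setT f -> measurable A -> measurable (f @^-1` A).
Proof. by move=> mf mA; rewrite -[X in measurable X]setTI; exact: mf. Qed.

Lemma integral_indicZr d (T : measurableType d) (m : {measure set T -> \bar R})
    (A : set T) (c : \bar R) : measurable A -> 0 <= c ->
  \int[m]_x ((\1_A x)%:E * c) = m A * c.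
Proof.
move=> mA c0; rewrite ge0_integralZr ?integral_indic ?setIT//.
exact/measurable_EFinP/measurable_indic.
Qed.

Lemma lebesgue_measure_translation (c : R) (A : set Rm) : measurable A ->
  leb ((fun x : Rm => (x + c)%R : Rm) @^-1` A) = leb A.
Proof.
move=> mA; have mf : measurable_fun setT (fun x : Rm => (x + c)%R : Rm).
  exact: measurable_funD.
pose nu : {measure set Rm -> \bar R} :=
  measure_function_pushforward__canonical__measure_function_Measure leb mf.
rewrite -[LHS]/(nu A); apply/esym/lebesgue_measure_unique => //= _ [[a b]] _ <-.
rewrite /pushforward (_ : _ @^-1` _ = `](a - c)%R, (b - c)%R]%classic); last first.
  by apply/seteqP; split => x /=; rewrite !in_itv/= ltrBlDr lerBrDr.
rewrite !lebesgue_measure_itv/= !lte_fin ltrD2r; case: ifP => // _.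
by rewrite -!EFinB opprB addrA subrK.
Qed.

Lemma lebesgue_measure_scale (k : R) (A : set Rm) : k != 0%R -> measurable A ->
  `|k|%:E * leb ((fun x : Rm => (k * x)%R : Rm) @^-1` A) = leb A.
Proof.
move=> k0 mA; have mf : measurable_fun setT (fun x : Rm => (k * x)%R : Rm).
  exact: measurable_funM.
pose nu : {measure set Rm -> \bar R} :=
  measure_function_pushforward__canonical__measure_function_Measure leb mf.
pose k' : {nonneg R} := NngNum (normr_ge0 k).
rewrite -[LHS]/(mscale k' nu A); apply/esym/lebesgue_measure_unique => //= _ [[a b]] _ <-.
rewrite /mscale /= /pushforward.
have [kp|kn|] := ltgtP 0%R k; last by move=> k0'; rewrite -k0' eqxx in k0.
- rewrite (_ : _ @^-1` _ = `](a / k)%R, (b / k)%R]%classic); last first.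
    by apply/seteqP; split => x /=; rewrite !in_itv/= ltr_pdivrMr// ler_pdivlMr// mulrC.
  rewrite !lebesgue_measure_itv/= !lte_fin ltr_pM2r ?invr_gt0//.
  case: ifP => _; rewrite ?mule0//.
  by rewrite -EFinB -EFinM -mulrBl gtr0_norm// mulrCA divff// mulr1 EFinB.
(* A negative factor reverses the interval: the closed end is now the left one, which does not
   affect the length. *)
- rewrite (_ : _ @^-1` _ = `[(b / k)%R, (a / k)%R[%classic); last first.
    apply/seteqP; split => x /=; rewrite !in_itv/= ltr_ndivlMr// ler_ndivrMr// mulrC;
    by rewrite andbC.
  rewrite !lebesgue_measure_itv/= !lte_fin ltr_nM2r ?invr_lt0//.
  case: ifP => _; rewrite ?mule0//.
  rewrite -EFinB -EFinM -mulrBl ltr0_norm// mulNr mulrCA divff// mulr1.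
  by rewrite opprB EFinB.
Qed.

(** The pushforward agrees with the product measure on rectangles, and these determine it. This is
    the induction step for translation invariance in R^n. *)
Lemma product_measure_preserved d1 d2 (T1 : measurableType d1)
    (T2 : measurableType d2) (m1 : {sigma_finite_measure set T1 -> \bar R})
    (m2 : {sigma_finite_measure set T2 -> \bar R}) (f1 : T1 -> T1) (f2 : T2 -> T2) :
  measurable_fun setT f1 -> measurable_fun setT f2 ->
  (forall A, measurable A -> m1 (f1 @^-1` A) = m1 A) ->
  (forall A, measurable A -> m2 (f2 @^-1` A) = m2 A) ->
  forall A, measurable A ->
    (m1 \x m2) ((fun z => (f1 z.1, f2 z.2)) @^-1` A) = (m1 \x m2) A.
Proof.
move=> mf1 mf2 m1f m2f A mA.
have mf : measurable_fun setT (fun z : T1 * T2 => (f1 z.1, f2 z.2)).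
  by apply: measurable_fun_pair; apply: measurableT_comp.
pose nu : {measure set (T1 * T2) -> \bar R} :=
  measure_function_pushforward__canonical__measure_function_Measure (m1 \x m2) mf.
apply/esym; rewrite -[RHS]/(nu A); apply: product_measure_unique => // B C mB mC.
rewrite -[LHS]/((m1 \x m2) ((f1 @^-1` B) `*` (f2 @^-1` C))).
have mfB : measurable (f1 @^-1` B) by exact: measurable_preimage mB.
have mfC : measurable (f2 @^-1` C) by exact: measurable_preimage mC.
by rewrite product_measure1E//; congr (_ * _); [exact: m1f|exact: m2f].
Qed.

Definition tadd n (s t : n.-tuple Rm) : n.-tuple Rm :=
  [tuple (tnth s i + tnth t i)%R | i < n].

Definition topp n (s : n.-tuple Rm) : n.-tuple Rm := [tuple (- tnth s i)%R | i < n].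

Lemma taddC n : commutative (@tadd n).
Proof. by move=> s t; apply: eq_from_tnth => i; rewrite !tnth_mktuple addrC. Qed.

Lemma taddK n (s t : n.-tuple Rm) : tadd (tadd s t) (topp s) = t.
Proof. by apply: eq_from_tnth => i; rewrite !tnth_mktuple addrAC subrr add0r. Qed.

Lemma toppD n (s t : n.-tuple Rm) : topp (tadd s t) = tadd (topp s) (topp t).
Proof. by apply: eq_from_tnth => i; rewrite !tnth_mktuple opprD. Qed.

Lemma toppK n : involutive (@topp n).
Proof. by move=> s; apply: eq_from_tnth => i; rewrite !tnth_mktuple opprK. Qed.

Lemma measurable_tadd d (T : measurableType d) n (f g : T -> n.-tuple Rm) :
  measurable_fun setT f -> measurable_fun setT g ->
  measurable_fun setT (fun x => tadd (f x) (g x)).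
Proof.
move=> mf mg; apply/measurable_fun_tnthP => i.
rewrite (_ : _ \o _ = (fun x => (tnth (f x) i + tnth (g x) i)%R)); last first.
  by apply/funext => x /=; rewrite tnth_mktuple.
apply: measurable_funD; first exact: (measurable_fun_tnthP _).1 mf i.
exact: (measurable_fun_tnthP _).1 mg i.
Qed.

Lemma measurable_topp n : measurable_fun setT (@topp n).
Proof.
apply/measurable_fun_tnthP => i.
rewrite (_ : _ \o _ = (fun x => (- tnth x i)%R)); last first.
  by apply/funext => x /=; rewrite tnth_mktuple.
apply: measurableT_comp; first exact: oppr_measurable.
exact: measurable_tnth.
Qed.

Lemma lebesgue_tupleS n (A : set (n.+1.-tuple Rm)) :
  lebesgue_tuple n.+1 A = (leb \x lebesgue_tuple n) (@tcons R n @^-1` A).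
Proof. by []. Qed.

Lemma lebesgue_tuple_translation n (s : n.-tuple Rm) A : measurable A ->
  lebesgue_tuple n (tadd s @^-1` A) = lebesgue_tuple n A.
Proof.
elim: n s A => [|n IH] s A mA.
  congr (lebesgue_tuple 0 _); apply/seteqP.
  by split=> t; rewrite /preimage/= [tadd s t]tuple0 [t]tuple0.
rewrite !lebesgue_tupleS.
pose f1 (x : Rm) : Rm := (x + thead s)%R.
rewrite -comp_preimage.
have -> : tadd s \o @tcons R n =
    @tcons R n \o (fun z => (f1 z.1, tadd [tuple of behead s] z.2)).
  apply/funext => z; apply: eq_from_tnth => i /=; rewrite tnth_mktuple.
  rewrite {1}(tuple_eta s) /tcons.
  case: (unliftP ord0 i) => [j|] ->; last by rewrite !tnth0 addrC.
  by rewrite !tnthS tnth_mktuple.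
rewrite comp_preimage; apply: (product_measure_preserved (f1 := f1)).
- exact: measurable_funD.
- exact: measurable_tadd.
- by move=> B mB; exact: lebesgue_measure_translation.
- by move=> B mB; exact: IH.
- by apply: measurable_preimage => //; exact: measurable_tcons.
Qed.

(* Fubini on {(x, y) | x \in B, x + y \in A} computes both sides. *)
Lemma translation_invariant_unique n (m1 m2 : {sigma_finite_measure set (n.-tuple Rm) -> \bar R}) :
  (forall s A, measurable A -> m1 (tadd s @^-1` A) = m1 A) ->
  (forall s A, measurable A -> m2 (tadd s @^-1` A) = m2 A) ->
  forall A B, measurable A -> measurable B -> @topp n @^-1` B = B ->
  m1 B * m2 A = m2 B * m1 A.
Proof.
move=> m1T m2T A B mA mB symB.
pose S := [set z : n.-tuple Rm * n.-tuple Rm | B z.1 /\ A (tadd z.1 z.2)].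
have mS : measurable S.
  have -> : S = (B `*` setT) `&` (fun z => tadd z.1 z.2) @^-1` A.
    by apply/seteqP; split => z /=; [case=> []|case=> -[]].
  apply: measurableI; first exact: measurableX.
  by apply: measurable_preimage => //; exact: measurable_tadd.
have m12S : (m1 \x m2) S = m1 B * m2 A.
  rewrite /product_measure1 /=.
  transitivity (\int[m1]_x ((\1_B x)%:E * m2 A)); last first.
    by rewrite integral_indicZr.
  apply: eq_integral => x _ /=; rewrite indicE.
  have [xB|xB] := boolP (x \in B).
    rewrite mul1e -(m2T x A mA); congr (m2 _).
    apply/seteqP; split => y; rewrite /xsection/= inE; first by case.
    by move=> Axy; split => //; exact: set_mem.
  rewrite mul0e (_ : xsection S x = set0) ?measure0//.
  rewrite -subset0 => y; rewrite /xsection/= inE => -[Bx _].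
  by rewrite notin_setE in xB.
have m21S : (m1 \x^ m2) S = m2 B * m1 A.
  rewrite /product_measure2 /=.
  (* For fixed y, translation by y turns the section of [S] into that of [S'], where x itself ranges
     over A. For fixed x there remains {y | x - y in B}, a translate of -B; here the symmetry of B
     enters. *)
  pose S' := [set z : n.-tuple Rm * n.-tuple Rm | A z.1 /\ B (tadd z.1 (topp z.2))].
  have mS' : measurable S'.
    have -> : S' = (A `*` setT) `&` (fun z => tadd z.1 (topp z.2)) @^-1` B.
      by apply/seteqP; split => z /=; [case=> []|case=> -[]].
    apply: measurableI; first exact: measurableX.
    apply: measurable_preimage => //; apply: measurable_tadd => //.
    exact: measurableT_comp (@measurable_topp n) _.
  transitivity ((m1 \x^ m2) S').
    rewrite /product_measure2 /=; apply: eq_integral => y _ /=.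
    rewrite -[RHS](m1T y)//; last exact: measurable_ysection.
    congr (m1 _); apply/seteqP; split => x; rewrite /ysection/= !inE/= => -[].
      by move=> Bx Axy; split; rewrite ?taddK// taddC.
    by rewrite taddK => Ayx Bx; split => //; rewrite taddC.
  transitivity ((m1 \x m2) S').
    apply/esym; apply: product_measure_unique => // C D mC mD.
    exact: product_measure2E.
  rewrite muleC /product_measure1 /=.
  transitivity (\int[m1]_x ((\1_A x)%:E * m2 B)); last first.
    by rewrite integral_indicZr.
  apply: eq_integral => x _ /=; rewrite indicE.
  have [xA|xA] := boolP (x \in A).
    rewrite mul1e -(m2T (topp x) B mB); congr (m2 _).
    apply/seteqP; split => y; rewrite /xsection/= inE/=.
      by move=> [_]; rewrite -{1}symB /preimage/= toppD toppK.
    by move=> Bxy; split; [exact: set_mem|rewrite -symB /preimage/= toppD toppK].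
  rewrite mul0e (_ : xsection S' x = set0) ?measure0//.
  rewrite -subset0 => y; rewrite /xsection/= inE => -[Ax _].
  by rewrite notin_setE in xA.
rewrite -m12S -m21S; apply: product_measure_unique => // C D mC mD.
exact: product_measure2E.
Qed.

Definition tcube n (r : R) : set (n.-tuple Rm) := [set t | forall i, (`|tnth t i| <= r)%R].

Lemma tcubeE n (r : R) : (0 <= r)%R ->
  measurable (@tcube n r) /\ lebesgue_tuple n (@tcube n r) = ((2 * r) ^+ n)%:E.
Proof.
move=> r0; elim: n => [|n [mC IH]].
  have -> : @tcube 0 r = setT by apply/seteqP; split => // t _ [].
  by split => //; rewrite /= diracT expr0.
have cE : @tcons R n @^-1` @tcube n.+1 r = (`[(- r)%R, r]%classic : set Rm) `*` @tcube n r.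
  apply/seteqP; split => -[x t]; rewrite /preimage/=.
    move=> H; split => /=.
      by have := H ord0; rewrite tnth0 in_itv/= ler_norml.
    by move=> i; have := H (lift ord0 i); rewrite tnthS.
  move=> [/= xr tr] i; case: (unliftP ord0 i) => [j|] ->; first by rewrite tnthS.
  by move: xr; rewrite in_itv/= tnth0 ler_norml.
have mC' : measurable (@tcube n.+1 r).
  rewrite (_ : @tcube n.+1 r = @tuncons R n @^-1` (@tcons R n @^-1` @tcube n.+1 r)).
    by rewrite cE; apply: measurable_preimage;
      [exact: measurable_tuncons|exact: measurableX].
  rewrite -comp_preimage (_ : _ \o _ = id)//; apply/funext; exact: tunconsK.
split => //; rewrite lebesgue_tupleS cE product_measure1E// IH.
transitivity ((2 * r)%:E * ((2 * r) ^+ n)%:E); last by rewrite -EFinM exprS.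
congr (_ * _); rewrite [LHS]lebesgue_measure_itv/= lte_fin; case: ltP => [_|rr].
  by rewrite -EFinB opprK; congr (_ %:E); ring.
have -> : r = 0%R by apply/le_anti; rewrite r0 andbT (le_trans rr)// oppr_le0.
by rewrite mulr0.
Qed.

Definition sqnorm n (t : n.-tuple Rm) : R := (\sum_(i < n) tnth t i ^+ 2)%R.

Lemma measurable_sqnorm n : measurable_fun setT (@sqnorm n : n.-tuple Rm -> Rm).
Proof.
apply: measurable_sum => i; apply: measurable_funX; exact: measurable_tnth.
Qed.

(** The radius sqrt n makes the ball contain the cube of half-side 1, so that cubes bound its
    measure on both sides. The ball is the test set for comparing measures: symmetric, of positive
    finite measure, and preserved by rotations. *)
Definition tball n : set (n.-tuple Rm) := [set t | (sqnorm t <= n%:R)%R].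

Lemma measurable_tball n : measurable (@tball n).
Proof.
rewrite (_ : @tball n = @sqnorm n @^-1` (`]-oo, n%:R]%classic : set Rm)).
  by apply: measurable_preimage => //; exact: measurable_sqnorm.
by apply/seteqP; split => t; rewrite /preimage/= in_itv.
Qed.

Lemma lebesgue_tball n :
  0 < lebesgue_tuple n (@tball n) /\ lebesgue_tuple n (@tball n) < +oo.
Proof.
have [mC1 C1] := tcubeE n (@ler01 R); have [mCn Cn] := tcubeE n (ler0n R n.+1).
split.
  apply: (@lt_le_trans _ _ (lebesgue_tuple n (@tcube n 1%R))).
    by rewrite C1 lte_fin exprn_gt0// mulr1.
  apply: le_measure; rewrite ?inE//; first exact: measurable_tball.
  move=> t /= t1; rewrite /tball /sqnorm/=.
  apply: (@le_trans _ _ (\sum_(i < n) 1)%R); last by rewrite sumr_const card_ord.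
  by apply: ler_sum => i _; rewrite -(real_normK (num_real _)) exprn_ile1.
apply: (@le_lt_trans _ _ (lebesgue_tuple n (@tcube n n.+1%:R))); last first.
  by rewrite Cn ltry.
apply: le_measure; rewrite ?inE//; first exact: measurable_tball.
move=> t /= t1 i; rewrite -(ler_pXn2r (ltn0Sn 1))// ?nnegrE//.
rewrite real_normK ?num_real//; apply: le_trans (_ : (n%:R <= _)%R).
  apply: le_trans t1; rewrite /sqnorm (bigD1 i)//= lerDl sumr_ge0// => j _.
  exact: sqr_ge0.
rewrite -natrX ler_nat; apply: leq_trans (leqnSn _) _.
by rewrite -[X in (X <= _)%N]expn1 leq_pexp2l.
Qed.

End MeasureInvariance.

(** * Orthonormal bases, coordinates, and rotation invariance of Lebesgue measure *)

Section OrthonormalCoordinates.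
Context {R : realType} {V : vectType R}.
Variable dot : {dot V for idfun}.
Local Notation Rm := (measurableTypeR R).
Implicit Types (X : {vspace V}) (u v e : V).

Definition onb X n (b : n.-tuple V) : Prop := basis_of X b /\ orthonormal dot b.

Lemma orthonormal_tnth n (b : n.-tuple V) i j :
  orthonormal dot b -> dot (tnth b i) (tnth b j) = (i == j)%:R.
Proof.
move=> /andP[/allP b1 bo].
have H (s : seq V) k l : pair_ortho_rec dot s -> (k < l < size s)%N ->
    dot (nth 0 s k) (nth 0 s l) = 0.
  elim: s k l => [|x s IH] k l /=; first by rewrite andbF.
  rewrite andbT => /andP[/allP xs ps] /andP[].
  case: l => // l; case: k => [_|k] ls; last by move=> sl; apply: IH => //; apply/andP.
  by apply/eqP/xs/mem_nth.
rewrite !(tnth_nth 0); have [->|ij] := eqVneq i j.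
  by apply/eqP/b1; rewrite mem_nth ?size_tuple.
have [lij|lji|eij] := ltngtP i j; last by rewrite (val_inj eij) eqxx in ij.
  by rewrite H// lij size_tuple/=.
by rewrite dotC H// lji size_tuple/=.
Qed.

Lemma unit_notin_orthov X e : e \in X -> dot e e = 1 -> e \notin orthov dot X.
Proof.
move=> eX e1; apply/mem_orthovPn; exists e => //; apply/eqP => e0.
by move: e1; rewrite [LHS]e0 => /eqP; rewrite eq_sym oner_eq0.
Qed.

(** One Gram-Schmidt step. It also completes an orthonormal basis of a hyperplane by its unit
    normal, which gives coordinates of V adapted to H_e. *)
Lemma onb_cons X e n (b : n.-tuple V) : e \in X -> dot e e = 1 ->
  onb (X :&: orthov dot <[e]>)%VS b -> onb X [tuple of e :: b].
Proof.
move=> eX e1 [bb bo]; split.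
  have dX : (\dim X).-1 = n.
    rewrite (@eq_dim_orthov1 _ _ _ _ dot e); first by rewrite -(size_basis bb).
    exact: unit_notin_orthov.
  have X0 : (0 < \dim X)%N.
    rewrite lt0n dimv_eq0; apply: contra_eqN e1 => /eqP X0.
    move: eX; rewrite X0 memv0 => /eqP ->.
    by rewrite [dot 0 0]linear0r eq_sym oner_eq0.
  rewrite basisEdim /= size_tuple (_ : n.+1 = \dim X); last by rewrite -dX prednK.
  rewrite leqnn andbT.
  apply/subvP => x xX; rewrite (_ : x = dot e x *: e + (x - dot e x *: e));
    last by rewrite addrC subrK.
  apply: memvD; first by apply/memvZ/memv_span; rewrite inE eqxx.
  have : x - dot e x *: e \in <<b>>%VS.
    rewrite (span_basis bb) memv_cap memvB ?memvZ//= mem_orthov1_sym mem_orthov1.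
    by rewrite linearBr/= dotZr e1 mulr1 subrr.
  by apply: subvP; apply: sub_span => y; rewrite inE orbC => ->.
rewrite /orthonormal/= e1 eqxx/=; move: bo => /andP[-> ->]; rewrite !andbT/=.
apply/allP => x xb /=; have : x \in (X :&: orthov dot <[e]>)%VS.
  by rewrite -(span_basis bb) memv_span.
by rewrite memv_cap => /andP[_]; rewrite mem_orthov1_sym mem_orthov1.
Qed.

Lemma onb_exists X n : \dim X = n -> exists b : n.-tuple V, onb X b.
Proof.
elim: n X => [|n IH] X dX.
  exists [tuple]; split => //; rewrite basisEdim /= dX leqnn andbT.
  by move/eqP: dX; rewrite dimv_eq0 => /eqP ->; exact: sub0v.
have : vpick X != 0 by rewrite vpick0 -dimv_eq0 dX.
set x := vpick X => x0.
have xx : 0 < dot x x by exact: neq0_dnorm_gt0.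
pose e := (Num.sqrt (dot x x))^-1 *: x.
have e1 : dot e e = 1.
  by rewrite dotZZ exprVn sqr_sqrtr ?dot_ge0// mulVf// gt_eqF.
have eX : e \in X by rewrite memvZ ?memv_pick.
have [|b bP] := IH (X :&: orthov dot <[e]>)%VS.
  by rewrite -eq_dim_orthov1 ?dX//; exact: unit_notin_orthov.
by exists [tuple of e :: b]; exact: onb_cons.
Qed.

Lemma onbasisP X : onb X (onbasis dot X).
Proof.
rewrite /onbasis; case: xgetP => [b _ //|H].
have [b bP] := onb_exists (erefl (\dim X)).
by exfalso; apply: (H b).
Qed.

(** [of_coord] for an arbitrary tuple of vectors, because several orthonormal bases of one space
    have to be compared; for [onbasis] the two are convertible. *)
Definition lincomb n (b : n.-tuple V) (c : n.-tuple Rm) : V :=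
  \sum_(i < n) (tnth c i : R) *: tnth b i.

Definition coords n (b : n.-tuple V) v : n.-tuple Rm :=
  [tuple dot (tnth b i) v | i < n].

Lemma lincombD n (b : n.-tuple V) s t :
  lincomb b (tadd s t) = lincomb b s + lincomb b t.
Proof.
rewrite /lincomb -big_split/=; apply: eq_bigr => i _.
by rewrite tnth_mktuple scalerDl.
Qed.

Lemma lincomb_tcons n e (b : n.-tuple V) x c :
  lincomb [tuple of e :: b] (tcons (x, c)) = (x : R) *: e + lincomb b c.
Proof.
rewrite /lincomb big_ord_recl /tcons/= !tnth0; congr (_ + _).
by apply: eq_bigr => i _; rewrite !tnthS.
Qed.

Lemma lincomb_mem X n (b : n.-tuple V) c : onb X b -> lincomb b c \in X.
Proof.
move=> [bb _]; apply: memv_suml => i _; apply: memvZ.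
by rewrite (basis_mem bb)// mem_tnth.
Qed.

Lemma dot_lincomb n (b : n.-tuple V) v c :
  dot v (lincomb b c) = \sum_(i < n) tnth c i * dot v (tnth b i).
Proof. by rewrite /lincomb linear_sumr/=; apply: eq_bigr => i _; rewrite dotZr. Qed.

Lemma lincombK X n (b : n.-tuple V) : onb X b -> cancel (lincomb b) (coords b).
Proof.
move=> [bb bo] c; apply: eq_from_tnth => i; rewrite tnth_mktuple dot_lincomb.
rewrite (bigD1 i)//= orthonormal_tnth// eqxx mulr1 big1 ?addr0// => j ji.
by rewrite orthonormal_tnth// eq_sym (negPf ji) mulr0.
Qed.

Lemma coordsK X n (b : n.-tuple V) v : onb X b -> v \in X ->
  lincomb b (coords b v) = v.
Proof.
move=> bP; have [bb bo] := bP; rewrite -{1}(span_basis bb) => /coord_span ->.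
rewrite -[RHS]/(\sum_(i < n) _); set w := \sum_(i < n) _.
pose c : n.-tuple Rm := [tuple coord b i v | i < n].
have -> : w = lincomb b c.
  by apply: eq_bigr => i _; rewrite tnth_mktuple (tnth_nth 0).
by rewrite (lincombK bP).
Qed.

Lemma dot_lincomb2 X n (b : n.-tuple V) c : onb X b ->
  dot (lincomb b c) (lincomb b c) = sqnorm c.
Proof.
move=> bP; rewrite dot_lincomb; apply: eq_bigr => i _.
rewrite dotC expr2; congr (_ * _).
by have := congr1 (fun t => tnth t i) (lincombK bP c); rewrite tnth_mktuple.
Qed.

Lemma measurable_dot_lincomb n (b : n.-tuple V) v :
  measurable_fun setT (fun c => dot v (lincomb b c) : Rm).
Proof.
rewrite (_ : (fun c => _) = (fun c => \sum_(i < n) tnth c i * dot v (tnth b i))).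
  apply: measurable_sum => i; apply: measurable_funM => //; exact: measurable_tnth.
by apply/funext => c; rewrite dot_lincomb.
Qed.

Lemma measurable_coords d (T : measurableType d) n (b : n.-tuple V) (f : T -> V) :
  (forall i, measurable_fun setT (fun x => dot (tnth b i) (f x) : Rm)) ->
  measurable_fun setT (fun x => coords b (f x)).
Proof.
move=> mf; apply/measurable_fun_tnthP => i.
by rewrite (_ : _ \o _ = fun x => dot (tnth b i) (f x))//;
  apply/funext => x /=; rewrite tnth_mktuple.
Qed.

(** The change of coordinates [M] is linear and preserves [sqnorm]. Hence the pushforward [nu] of
    Lebesgue measure under [M] is translation invariant and gives the ball its old measure; dividing
    by that measure in [translation_invariant_unique] identifies the two. *)
Lemma lebesgue_rotation n (b b' : n.-tuple V) (A : set V) :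
  onb fullv b -> onb fullv b' -> measurable (lincomb b @^-1` A) ->
  measurable (lincomb b' @^-1` A) /\
  lebesgue_tuple n (lincomb b' @^-1` A) = lebesgue_tuple n (lincomb b @^-1` A).
Proof.
move=> bP b'P mA.
pose M c := coords b (lincomb b' c).
have mM : measurable_fun setT M.
  by apply: measurable_coords => i; exact: measurable_dot_lincomb.
have ME c : lincomb b (M c) = lincomb b' c by rewrite (coordsK bP)// memvf.
have AE : lincomb b' @^-1` A = M @^-1` (lincomb b @^-1` A).
  by apply/seteqP; split => c; rewrite /preimage/= ME.
pose nu : {measure set (n.-tuple Rm) -> \bar R} :=
  measure_function_pushforward__canonical__measure_function_Measure (lebesgue_tuple n) mM.
(* Fubini needs [nu] to be sigma-finite. Since [N] is the inverse of [M], the preimages under [N] of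
   an exhaustion keep their finite measures. *)
have sN : sigma_finite setT nu.
  have /sigma_finiteP[F [FT ndF mF]] := sigma_finiteT (@lebesgue_tuple R n).
  pose N c := coords b' (lincomb b c).
  have mN : measurable_fun setT N.
    by apply: measurable_coords => i; exact: measurable_dot_lincomb.
  exists (fun i => N @^-1` F i).
    by rewrite -preimage_bigcup -FT.
  move=> i; have [mFi Fi] := mF i; split; first exact: measurable_preimage.
  rewrite /nu/= /pushforward -comp_preimage (_ : _ \o _ = id)//.
  by apply/funext => c /=; rewrite /N ME (lincombK b'P).
pose nu' : {sigma_finite_measure set (n.-tuple Rm) -> \bar R} :=
  HB.pack (nu : set _ -> _) (Measure.on nu) (Measure_isSigmaFinite.Build _ _ _ nu sN).
split; first by rewrite AE; exact: measurable_preimage.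
have nuT s B : measurable B -> nu' (tadd s @^-1` B) = nu' B.
  move=> mB; rewrite /nu'/= /pushforward.
  rewrite -[RHS](lebesgue_tuple_translation (coords b' (lincomb b s)));
    last exact: measurable_preimage.
  have MT c : M (tadd (coords b' (lincomb b s)) c) = tadd s (M c).
    by rewrite {1}/M lincombD (coordsK b'P) ?memvf// -ME -lincombD (lincombK bP).
  by congr (lebesgue_tuple n _); apply/seteqP; split => c; rewrite /preimage/= MT.
have [B0 Boo] := lebesgue_tball (R := R) n.
have nuB : nu' (@tball R n) = lebesgue_tuple n (@tball R n).
  rewrite /nu'/= /pushforward; congr (lebesgue_tuple n _).
  have sqM c : sqnorm (M c) = sqnorm c.
    by rewrite -(dot_lincomb2 (M c) bP) ME (dot_lincomb2 c b'P).
  by apply/seteqP; split => c; rewrite /preimage/= /tball/= sqM.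
have := @translation_invariant_unique R n nu' (lebesgue_tuple n) nuT
  (@lebesgue_tuple_translation R n) _ _ mA (@measurable_tball R n).
have nuA : nu' (lincomb b @^-1` A) = lebesgue_tuple n (lincomb b' @^-1` A).
  by rewrite /nu'/= /pushforward -AE.
rewrite nuB nuA => H; have /H : @topp R n @^-1` @tball R n = @tball R n.
  have sqN c : sqnorm (@topp R n c) = sqnorm c.
    by apply: eq_bigr => i _; rewrite tnth_mktuple sqrrN.
  by apply/seteqP; split => c; rewrite /preimage/= /tball/= sqN.
have BE : lebesgue_tuple n (@tball R n) \is a fin_num by rewrite ge0_fin_numE.
rewrite -(fineK BE) => /esym.
by move/(congr1 (fun x => ((fine (lebesgue_tuple n (@tball R n)))^-1%:E * x)%E));
  rewrite !muleA -EFinM mulVf ?mul1e// gt_eqF// fine_gt0// B0.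
Qed.

End OrthonormalCoordinates.

(** * Integrals off null sets, and change of variables with a constant Jacobian *)

Section IntegralTransfer.
Context {R : realType}.
Local Open Scope ereal_scope.

Import HBNNSimple.

(* The integral is a supremum over simple functions, and multiplying these by
   the indicator of the complement of N does not change their integrals. *)
Lemma integral_eq_off_null d (T : measurableType d) (mu : {measure set T -> \bar R})
    (N D : set T) (f g : T -> \bar R) :
  measurable N -> mu N = 0 -> (forall x, D x -> ~ N x -> f x = g x) ->
  \int[mu]_(x in D) f x = \int[mu]_(x in D) g x.
Proof.
move=> mN N0 fg.
have mNc : measurable (~` N) by exact: measurableC.
have H (u v : T -> \bar R) : (forall x, ~ N x -> u x = v x) ->
    (forall x, 0 <= v x) ->
    ereal_sup [set sintegral mu h | h in [set h : {nnsfun T >-> R} | forall x, (h x)%:E <= u x]]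
    <= ereal_sup [set sintegral mu h | h in [set h : {nnsfun T >-> R} | forall x, (h x)%:E <= v x]].
  move=> uv v0; apply: ge_ereal_sup => _ [h hu <-].
  apply: ereal_sup_ubound; exists (proj_nnsfun h mNc) => /=.
    move=> x; rewrite mindicE; case: (boolP (x \in ~` N)) => xN.
      by rewrite mulr1 -uv; [exact: hu|exact: set_mem xN].
    by rewrite mulr0.
  rewrite -!integralT_nnsfun; apply: ge0_ae_eq_integral => //.
  - exact/measurable_EFinP.
  - exact/measurable_EFinP.
  - by move=> x _; rewrite lee_fin.
  - by move=> x _; rewrite lee_fin.
  exists N; split => // x /=; apply: contra_notP => xN _.
  by congr (_%:E); rewrite mindicE mem_set// mulr1.
have E (u v : T -> \bar R) : (forall x, ~ N x -> u x = v x) ->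
    (forall x, 0 <= v x) -> (forall x, 0 <= u x) ->
    ereal_sup [set sintegral mu h | h in [set h : {nnsfun T >-> R} | forall x, (h x)%:E <= u x]]
    = ereal_sup [set sintegral mu h | h in [set h : {nnsfun T >-> R} | forall x, (h x)%:E <= v x]].
  move=> uv v0 u0; apply/le_anti/andP; split; apply: H => // x /uv ->//.
have fgD x : ~ N x -> (f \_ D) x = (g \_ D) x.
  by move=> Nx; rewrite !patchE; case: ifPn => // /set_mem Dx; rewrite fg.
rewrite /integral; congr (_ - _); apply: E => x //; move=> /fgD.
- by rewrite !funeposE => ->.
- by rewrite !funenegE => ->.
Qed.

Lemma Rintegral_eq_off_null d (T : measurableType d) (mu : {measure set T -> \bar R})
    (N D : set T) (f g : T -> R) :
  measurable N -> mu N = 0 -> (forall x, D x -> ~ N x -> f x = g x) ->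
  (\int[mu]_(x in D) f x = \int[mu]_(x in D) g x)%R.
Proof.
move=> mN N0 fg; rewrite /Rintegral; congr fine.
by apply: integral_eq_off_null mN N0 _ => x Dx Nx; rewrite fg.
Qed.

Section Transfer.
Context d1 d2 (X : measurableType d1) (Y : measurableType d2).
Variables (mX : {measure set X -> \bar R}) (mY : {measure set Y -> \bar R}).
Variables (phi : X -> Y) (k : R).
Hypotheses (mphi : measurable_fun setT phi) (k0 : (0 < k)%R).
Hypothesis phiE : forall A, measurable A -> k%:E * mX (phi @^-1` A) = mY A.

(** By [phiE], [mY] is the pushforward of [mX] under [phi] scaled by the Jacobian [k]. *)
Lemma ge0_integral_transfer (f : Y -> \bar R) : measurable_fun setT f ->
  (forall y, 0 <= f y) -> \int[mY]_y f y = k%:E * \int[mX]_x f (phi x).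
Proof.
move=> mf f0.
pose nu : {measure set Y -> \bar R} :=
  measure_function_pushforward__canonical__measure_function_Measure mX mphi.
pose k' : {nonneg R} := NngNum (ltW k0).
transitivity (\int[mscale k' nu]_y f y).
  by apply: eq_measure_integral => A mA _; rewrite -phiE.
by rewrite ge0_integral_mscale// ge0_integral_pushforward.
Qed.

Lemma integrable_transfer (f : Y -> \bar R) : mY.-integrable setT f ->
  mX.-integrable setT (f \o phi).
Proof.
move=> /integrableP[mf fi]; apply/integrableP; split.
  exact: measurableT_comp.
move: fi; rewrite ge0_integral_transfer//; last exact: measurableT_comp.
apply: contraTT; rewrite -!leNgt !leye_eq => /eqP ->.
by rewrite gt0_muley// lte_fin.
Qed.

Lemma integral_transfer (f : Y -> \bar R) : mY.-integrable setT f ->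
  \int[mY]_y f y = k%:E * \int[mX]_x f (phi x).
Proof.
move=> fi; have mf := measurable_int mY fi.
have fp := integrable_transfer fi.
rewrite integralE [in RHS]integralE muleBr//; last first.
  by apply: fin_num_adde_defl; rewrite fin_numN; exact: integrable_neg_fin_num.
congr (_ - _); rewrite ge0_integral_transfer//.
- by congr (_ * _); apply: eq_integral => x _; rewrite !funeposE.
- exact: measurable_funepos.
- by congr (_ * _); apply: eq_integral => x _; rewrite !funenegE.
- exact: measurable_funeneg.
Qed.

Lemma Rintegral_transfer (f : Y -> R) : mY.-integrable setT (EFin \o f) ->
  (\int[mY]_y f y = k * \int[mX]_x f (phi x))%R.
Proof.
move=> fi; rewrite /Rintegral integral_transfer// fineM//.
exact: integrable_fin_num (integrable_transfer fi).
Qed.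

End Transfer.
End IntegralTransfer.

(** * The Jacobian of (t, y) |-> y - t a for y in H_e *)

Section Sweep.
Context {R : realType} {V : vectType R}.
Variable dot : {dot V for idfun}.
Local Notation Rm := (measurableTypeR R).
Local Notation leb := (@lebesgue_measure R).
Implicit Types (X : {vspace V}) (u v e : V).

(** In the orthonormal basis e, [b'] the point y - t a has coordinates -(a, e) t and y - t w, with w
    the component of a in H_e. The shear by w translates each slice and preserves volume; the
    scaling of t accounts for the factor |(a, e)|. *)
Lemma lebesgue_sweep n m (b : n.-tuple V) (b' : m.-tuple V) e a (A : set V) :
  n = m.+1 -> dot e e = 1 -> onb dot fullv b -> onb dot (orthov dot <[e]>) b' ->
  dot a e != 0 -> measurable (lincomb b @^-1` A) ->
  let Psi := fun z : Rm * m.-tuple Rm => lincomb b' z.2 - (z.1 : R) *: a in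
  measurable (Psi @^-1` A) /\
  (`|dot a e|%:E * (leb \x lebesgue_tuple m) (Psi @^-1` A)
     = lebesgue_tuple n (lincomb b @^-1` A))%E.
Proof.
move=> nm; subst n => e1 bP b'P ae mA Psi.
have beP : onb dot fullv [tuple of e :: b'].
  by apply: onb_cons => //; [exact: memvf|rewrite capfv].
have [mQ QE] := lebesgue_rotation bP beP mA.
set be := [tuple of e :: b'] in beP mQ QE.
set D := @tcons R m @^-1` (lincomb be @^-1` A).
have mD : measurable D by apply: measurable_preimage => //; exact: measurable_tcons.
rewrite -QE lebesgue_tupleS -/D.
set k := dot a e; pose w := a - k *: e.
have wX : w \in orthov dot <[e]>.
  rewrite mem_orthov1_sym mem_orthov1; apply/eqP.
  by rewrite linearBr/= dotZr e1 mulr1 dotC subrr.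
pose shift (t : Rm) := coords dot b' ((- (t : R)) *: w).
have mshift : measurable_fun setT shift.
  apply: measurable_coords => i.
  rewrite (_ : (fun x => _) = fun t : R => (- t) * dot (tnth b' i) w).
    by apply: measurable_funM => //; exact: oppr_measurable.
  by apply/funext => t; rewrite dotZr.
pose S (z : Rm * m.-tuple Rm) : Rm * m.-tuple Rm := ((- k) * z.1, tadd (shift z.1) z.2).
have mS : measurable_fun setT S.
  apply: measurable_fun_pair; first exact: measurable_funM.
  by apply: measurable_tadd => //; exact: measurableT_comp.
have PsiE z : Psi z = lincomb be (tcons (S z)).
  rewrite lincomb_tcons lincombD (coordsK b'P) ?memvZ// /Psi /w.
  rewrite scalerBr scalerA mulNr !scaleNr mulNr scaleNr opprK [z.1 * k]mulrC.
  by rewrite [- _ + _ *: e]addrC -addrA addKr addrC.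
have -> : Psi @^-1` A = S @^-1` D.
  by apply/seteqP; split => z; rewrite /preimage/= PsiE.
split; first exact: measurable_preimage.
pose phi := lebesgue_tuple m \o xsection D.
have mphi : measurable_fun setT phi by exact: measurable_fun_xsection.
rewrite {2}/product_measure1.
have k0 : (0 < `|- k|)%R by rewrite normr_gt0 oppr_eq0.
rewrite (@ge0_integral_transfer R _ _ Rm Rm leb leb (fun x => - k * x) `|- k|)//.
- rewrite normrN; congr (_ * _)%E; apply: eq_integral => t _ /=.
  rewrite -[RHS](lebesgue_tuple_translation (shift t)); last exact: measurable_xsection.
  by congr (lebesgue_tuple m _); apply/seteqP; split => c; rewrite /xsection/preimage/= !inE.
- exact: measurable_funM.
- by move=> B mB; apply: lebesgue_measure_scale => //; rewrite oppr_eq0.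
Qed.

End Sweep.

(** * Almost everywhere arguments for real-valued integrals and for slices of null sets *)

Section AlmostEverywhere.
Context {R : realType}.

Lemma Rintegral_ae d (T : measurableType d) (mu : {measure set T -> \bar R})
    (D : set T) (f g : T -> R) : {ae mu, forall x, D x -> f x = g x} ->
  \int[mu]_(x in D) f x = \int[mu]_(x in D) g x.
Proof.
move=> [N [mN N0 sN]]; apply: Rintegral_eq_off_null mN N0 _ => x Dx Nx.
by apply: contrapT => fg; apply/Nx/sN => /(_ Dx).
Qed.

Lemma Rintegral_sum d (T : measurableType d) (mu : {measure set T -> \bar R})
    (D : set T) I (s : seq I) (f : I -> T -> R) : measurable D ->
  (forall i, mu.-integrable D (EFin \o f i)) ->
  \int[mu]_(x in D) (\sum_(i <- s) f i x) = \sum_(i <- s) \int[mu]_(x in D) f i x.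
Proof.
move=> mD fi; rewrite /Rintegral.
under eq_integral do rewrite -sumEFin.
rewrite integral_sum// -sum_fine// => i _.
exact: (integrable_fin_num mD (fi i)).
Qed.

Lemma Rintegral_prod d1 d2 (T1 : measurableType d1) (T2 : measurableType d2)
    (m1 : {sigma_finite_measure set T1 -> \bar R})
    (m2 : {sigma_finite_measure set T2 -> \bar R}) (f : T1 * T2 -> R) :
  (m1 \x m2)%E.-integrable setT (EFin \o f) ->
  \int[(m1 \x m2)%E]_z f z = \int[m1]_x \int[m2]_y f (x, y).
Proof.
move=> fi; rewrite /Rintegral -integral12_prod_meas1//; congr fine.
(* [fine] alters an inner integral only where it is infinite, which can happen only on the null set
   of those x whose slice is not integrable. *)
have [N [mN N0 sN]] := ae_integrable1 fi.
apply: (integral_eq_off_null mN N0) => x _ Nx; rewrite /fubini_F fineK//.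
apply: integrable_fin_num => //; apply: contrapT => /= H.
exact/Nx/sN.
Qed.

Lemma integrable_bounded d (T : measurableType d) (mu : {measure set T -> \bar R})
    (f g : T -> R) (M : R) : measurable_fun setT g -> (forall x, `|g x| <= M) ->
  mu.-integrable setT (EFin \o f) -> mu.-integrable setT (EFin \o (fun x => f x * g x)).
Proof.
move=> mg gM fi; have /measurable_EFinP mf := measurable_int mu fi.
have Mfi := @integrableZl _ _ _ mu setT measurableT M _ fi.
apply: le_integrable Mfi => //; first by apply/measurable_EFinP; exact: measurable_funM.
move=> x _ /=; rewrite lee_fin normrM [X in _ <= X]normrM mulrC ler_wpM2r//.
exact: le_trans (gM x) (ler_norm _).
Qed.

Lemma ae_slice d1 d2 (T1 : measurableType d1) (T2 : measurableType d2)
    (m1 : {sigma_finite_measure set T1 -> \bar R})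
    (m2 : {sigma_finite_measure set T2 -> \bar R}) (A : set (T1 * T2)) :
  measurable A -> (m1 \x m2)%E A = 0%E ->
  {ae m1, forall x, measurable (xsection A x) /\ m2 (xsection A x) = 0%E}.
Proof.
move=> mA; rewrite /product_measure1 => A0.
have : ae_eq m1 setT (fun x => m2 (xsection A x)) (cst 0%E).
  apply/ae_eq_integral_abs => //; first exact: measurable_fun_xsection.
  by rewrite -[RHS]A0; apply: eq_integral => x _; rewrite gee0_abs.
apply: filterS => x /= /(_ I) ->; split => //; exact: measurable_xsection.
Qed.

End AlmostEverywhere.

(** * Increments of a product of functions with one jump each *)

Section Telescoping.
Context {R : realType}.

(* Splitting [l, r] at the jump of the head factor makes the sum over the other
   jumps telescope. *)
Lemma step_product_telescope (I : eqType) (s : seq I) (cross : pred I)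
    (tau A B : I -> R) (h : I -> R -> R) (l r : R) :
  uniq s -> l <= r ->
  (forall i, i \in s -> ~~ cross i -> forall t, h i t = A i) ->
  (forall i t, i \in s -> cross i -> t < tau i -> h i t = A i) ->
  (forall i t, i \in s -> cross i -> tau i < t -> h i t = B i) ->
  (forall i j, i \in s -> j \in s -> cross i -> cross j -> i != j -> tau i != tau j) ->
  (forall i, i \in s -> cross i -> tau i != l /\ tau i != r) ->
  \prod_(i <- s) h i r - \prod_(i <- s) h i l =
  \sum_(i <- s | cross i && (l < tau i < r))
     (B i - A i) * \prod_(j <- s | j != i) h j (tau i).
Proof.
move=> + + Hn HA HB; elim: s l r Hn HA HB => [|i s IH] l r Hn HA HB /=.
  by move=> *; rewrite !big_nil subrr.
move=> /andP[iNs us] lr Hd He.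
have IH' l' r' : l' <= r' ->
    (forall j, j \in s -> cross j -> tau j != l' /\ tau j != r') ->
    \prod_(i <- s) h i r' - \prod_(i <- s) h i l' =
    \sum_(i <- s | cross i && (l' < tau i < r'))
       (B i - A i) * \prod_(j <- s | j != i) h j (tau i).
  move=> lr' He'; apply: IH => //.
  - by move=> j js; apply: Hn; rewrite inE js orbT.
  - by move=> j t js; apply: HA; rewrite inE js orbT.
  - by move=> j t js; apply: HB; rewrite inE js orbT.
  - by move=> j k js ks; apply: Hd; rewrite inE ?js ?ks orbT.
have is_ : i \in i :: s by rewrite inE eqxx.
have sE j : j \in s -> j \in i :: s by rewrite inE orbC => ->.
have He' j : j \in s -> cross j -> tau j != l /\ tau j != r.
  by move=> /sE; exact: He.
have E1 : \prod_(j <- i :: s | j != i) h j (tau i) = \prod_(j <- s) h j (tau i).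
  rewrite big_cons eqxx/= big_seq_cond [RHS]big_seq; apply: eq_bigl => j.
  by case: (boolP (j \in s)) => //= js; apply: contraNneq iNs => <-.
have E2 j : j \in s -> \prod_(k <- i :: s | k != j) h k (tau j) =
    h i (tau j) * \prod_(k <- s | k != j) h k (tau j).
  by move=> js; rewrite big_cons ifT//; apply: contraNneq iNs => ->.
(* When the head factor takes the same value c at all the jumps that are summed over, it comes out
   of the sum. *)
have const c (P : pred I) : (forall j, j \in s -> P j -> h i (tau j) = c) ->
    \sum_(j <- s | P j) (B j - A j) * \prod_(k <- i :: s | k != j) h k (tau j) =
    c * \sum_(j <- s | P j) (B j - A j) * \prod_(k <- s | k != j) h k (tau j).
  move=> hc; rewrite mulr_sumr big_seq_cond [RHS]big_seq_cond.
  by apply: eq_bigr => j /andP[js Pj]; rewrite E2// hc// mulrCA.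
rewrite 3!big_cons; case: (boolP (cross i)) => ci /=; last first.
  rewrite (const (A i)) => [|j js _]; last exact: Hn.
  by rewrite -IH'// mulrBr !Hn.
have [til tir] := He i is_ ci.
have [ltil|ltli|eqti] := ltgtP (tau i) l; last by rewrite eqti eqxx in til.
  rewrite /= (const (B i)) => [|j js /andP[cj /andP[lj _]]]; last first.
    by apply: HB => //; exact: lt_trans lj.
  by rewrite -IH'// mulrBr !HB// (lt_le_trans ltil).
have [ltir|ltri|eqtr] := ltgtP (tau i) r; last by rewrite eqtr eqxx in tir.
  rewrite /= E1 [X in _ = _ + X](bigID (fun j => tau j < tau i))/=.
  rewrite (const (A i)) => [|j js /andP[/andP[cj _] ji]]; last exact: HA.
  rewrite (const (B i)) => [|j js /andP[/andP[cj _] ji]]; last first.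
    apply: HB => //; rewrite lt_neqAle leNgt ji andbT; apply: Hd => //; first exact: sE.
    by apply: contraNneq iNs => ->.
  have Hti j : j \in s -> cross j -> tau j != tau i.
    move=> js cj; apply: Hd => //; first exact: sE.
    by apply: contraNneq iNs => <-.
  pose G j := (B j - A j) * \prod_(k <- s | k != j) h k (tau j).
  have -> : \sum_(j <- s | (cross j && (l < tau j < r)) && (tau j < tau i)) G j =
      \prod_(j <- s) h j (tau i) - \prod_(j <- s) h j l.
    rewrite (IH' l (tau i) (ltW ltli)); last first.
      by move=> j js cj; split; [exact: (He' j js cj).1|exact: Hti].
    apply: eq_bigl => j; case: (ltP (tau j) (tau i)) => ji; rewrite ?andbF ?andbT//.
    by rewrite (lt_trans ji ltir) andbT.
  have -> : \sum_(j <- s | (cross j && (l < tau j < r)) && ~~ (tau j < tau i)) G j =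
      \prod_(j <- s) h j r - \prod_(j <- s) h j (tau i).
    rewrite (IH' (tau i) r (ltW ltir)); last first.
      by move=> j js cj; split; [exact: Hti|exact: (He' j js cj).2].
    rewrite big_seq_cond [RHS]big_seq_cond; apply: eq_bigl => j.
    case: (boolP (j \in s)) => //= js; case: (boolP (cross j)) => //= cj.
    rewrite -leNgt le_eqVlt eq_sym (negPf (Hti _ js cj))/=.
    case: (ltP (tau i) (tau j)) => ij; rewrite ?andbF ?andbT//.
    by rewrite (lt_trans ltli ij).
  (* With Q t the product over the tail and u = tau i: A (Q u - Q l) + (B - A) Q u + B (Q r - Q u) =
     B Q r - A Q l. *)
  by rewrite (HA i l)// (HB i r)//; ring.
have -> : true && false = false by [].
rewrite (const (A i)) => [|j js /andP[cj /andP[_ jr]]]; last first.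
  by apply: HA => //; exact: lt_trans ltri.
by rewrite -IH'// mulrBr !HA// (le_lt_trans lr).
Qed.

End Telescoping.

(** * Sweeping and translating integrals and null sets of V *)

Section SweepIntegral.
Context {R : realType} {V : vectType R}.
Variable dot : {dot V for idfun}.
Local Notation Rm := (measurableTypeR R).
Local Notation leb := (@lebesgue_measure R).
Local Notation mu X := (@lebesgue_tuple R (\dim X)).
Local Notation mV := (@lebesgue_tuple R (\dim {:V})).
Local Notation oV := (@of_coord R V dot fullv).
Implicit Types (X : {vspace V}) (u v e a x : V) (F : V -> R).

Lemma dim_hyperplane e : dot e e = 1 -> \dim {:V} = (\dim (hyperplane dot e)).+1.
Proof.
move=> e1; have /eq_dim_orthov1 := unit_notin_orthov (memvf e) e1.
rewrite capfv -/(hyperplane dot e) => <-; rewrite prednK// lt0n dimv_eq0.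
apply/eqP => V0; have := memvf e; rewrite V0 memv0 => /eqP e0.
by move: e1; rewrite e0 [LHS]linear0r => /eqP; rewrite eq_sym oner_eq0.
Qed.

Lemma mem_hyperplane e x : (x \in hyperplane dot e) = (dot e x == 0).
Proof. by rewrite /hyperplane mem_orthov1_sym mem_orthov1. Qed.

Definition sweep e a (z : Rm * (\dim (hyperplane dot e)).-tuple Rm) : V :=
  of_coord dot z.2 - (z.1 : R) *: a.

Lemma dotBZ v x a (t : R) : dot v (x - t *: a) = dot v x - t * dot v a.
Proof. by rewrite linearBr/= dotZr. Qed.

Lemma measurable_dot_of_coord X v :
  measurable_fun setT (fun c => dot v (@of_coord R V dot X c) : Rm).
Proof. exact: measurable_dot_lincomb. Qed.

Lemma measurable_dot_sweep e a v :
  measurable_fun setT (fun z => dot v (@sweep e a z) : Rm).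
Proof.
rewrite (_ : (fun z => _) = fun z => dot v (of_coord dot z.2) - z.1 * dot v a).
  apply: measurable_funB; last exact: measurable_funM.
  exact: measurableT_comp (@measurable_dot_of_coord _ _) _.
by apply/funext => z; rewrite dotBZ.
Qed.

Let psi e a z : (\dim {:V}).-tuple Rm := coords dot (onbasis dot fullv) (@sweep e a z).

Let psiE e a z : oV (psi a z) = @sweep e a z.
Proof. exact: (coordsK (onbasisP dot fullv) (memvf _)). Qed.

Let mpsi e a : measurable_fun setT (@psi e a).
Proof. by apply: measurable_coords => i; exact: measurable_dot_sweep. Qed.

Let sweepE e a A : dot e e = 1 -> dot a e != 0 -> measurable (oV @^-1` A) ->
  measurable (@sweep e a @^-1` A) /\
  (`|dot a e|%:E * (leb \x mu (hyperplane dot e)) (@sweep e a @^-1` A)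
    = mV (oV @^-1` A))%E.
Proof.
move=> e1 ae mA.
exact: (lebesgue_sweep (dim_hyperplane e1) e1 (onbasisP dot fullv)
  (onbasisP dot (hyperplane dot e)) ae mA).
Qed.

Let psi_transfer e a : dot e e = 1 -> dot a e != 0 -> forall A, measurable A ->
  (`|dot a e|%:E * (leb \x mu (hyperplane dot e)) (@psi e a @^-1` A) = mV A)%E.
Proof.
move=> e1 ae A mA.
pose A' := coords dot (onbasis dot fullv) @^-1` A.
have AE : oV @^-1` A' = A.
  by apply/seteqP; split => c; rewrite /A' /preimage/= (lincombK (onbasisP dot fullv)).
by have [|_] := @sweepE e a A' e1 ae; rewrite AE.
Qed.

Lemma integrable_sweep e a F : dot e e = 1 -> dot a e != 0 ->
  mV.-integrable setT (EFin \o (F \o oV)) ->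
  (leb \x mu (hyperplane dot e))%E.-integrable setT (EFin \o (F \o @sweep e a)).
Proof.
move=> e1 ae Fi.
have := integrable_transfer (mpsi a) _ (psi_transfer e1 ae) Fi.
rewrite normr_gt0 => /(_ ae); congr (_.-integrable _ _).
by apply/funext => z /=; rewrite psiE.
Qed.

Lemma Rintegral_sweep e a F : dot e e = 1 -> dot a e != 0 ->
  mV.-integrable setT (EFin \o (F \o oV)) ->
  \int[mV]_c F (oV c) =
  `|dot a e| * \int[(leb \x mu (hyperplane dot e))%E]_z F (@sweep e a z).
Proof.
move=> e1 ae Fi.
have := Rintegral_transfer (mpsi a) _ (psi_transfer e1 ae) Fi.
rewrite normr_gt0 => /(_ ae) ->; congr (_ * _).
by apply: eq_Rintegral => z _ /=; rewrite psiE.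
Qed.

Lemma null_sweep e a A : dot e e = 1 -> dot a e != 0 -> measurable (oV @^-1` A) ->
  mV (oV @^-1` A) = 0%E ->
  measurable (@sweep e a @^-1` A) /\
  (leb \x mu (hyperplane dot e))%E (@sweep e a @^-1` A) = 0%E.
Proof.
move=> e1 ae mA A0; have [mS] := sweepE e1 ae mA; rewrite A0 => /eqP.
by rewrite mule_eq0 eqe normr_eq0 (negPf ae)/= => /eqP.
Qed.

(** Swept along its unit normal e, an affine hyperplane becomes a single time t times all of H_e,
    hence a null set. *)
Lemma ae_neq_affine v (r : R) : v != 0 -> {ae mV, forall c, dot v (oV c) != r}.
Proof.
move=> v0; have vv : 0 < dot v v by exact: neq0_dnorm_gt0.
pose k := Num.sqrt (dot v v); have k0 : 0 < k by rewrite sqrtr_gt0.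
have kk : k ^+ 2 = dot v v by rewrite sqr_sqrtr// ltW.
pose e := k^-1 *: v.
have e1 : dot e e = 1 by rewrite dotZZ exprVn kk mulVf// gt_eqF.
have ve : dot v e = k by rewrite dotZr -kk expr2 mulKf// gt_eqF.
have ee0 : dot e e != 0 by rewrite e1 oner_eq0.
pose A := [set x | dot v x = r].
have mA : measurable (oV @^-1` A).
  rewrite (_ : _ @^-1` _ = (fun c => dot v (oV c)) @^-1` [set r])//.
  by apply: measurable_preimage => //; exact: measurable_dot_of_coord.
exists (oV @^-1` A); split => //; last first.
  by move=> c /= /negP; rewrite negbK => /eqP.
have [_ <-] := sweepE e1 ee0 mA.
rewrite e1 normr1 mul1e.
have -> : @sweep e e @^-1` A = [set (- (r / k))%R : Rm] `*` setT.
  apply/seteqP; split => -[t c]; rewrite /preimage/= /A/= dotBZ/= ve;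
    rewrite (_ : dot v _ = 0) ?sub0r.
  - by move=> <-; split => //; rewrite mulNr opprK mulfK// gt_eqF.
  - apply/eqP; rewrite -mem_hyperplane; have := lincomb_mem c (onbasisP dot (hyperplane dot e)).
    by rewrite !mem_hyperplane dotZl mulf_eq0 invr_eq0 gt_eqF.
  - by move=> [-> _]; rewrite mulNr opprK divfK// gt_eqF.
  - apply/eqP; rewrite -mem_hyperplane; have := lincomb_mem c (onbasisP dot (hyperplane dot e)).
    by rewrite !mem_hyperplane dotZl mulf_eq0 invr_eq0 gt_eqF.
by rewrite product_measure1E//= lebesgue_measure_set1 mul0e.
Qed.

Let shift a (c : (\dim {:V}).-tuple Rm) := tadd (coords dot (onbasis dot fullv) a) c.

Let shiftE a c : oV (shift a c) = a + oV c.
Proof.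
have bP := onbasisP dot fullv.
by rewrite /shift [LHS]lincombD (coordsK bP) ?memvf.
Qed.

Let mshift a : measurable_fun setT (shift a).
Proof. exact: measurable_tadd. Qed.

Let shift_transfer a A : measurable A -> (1%:E * mV (shift a @^-1` A) = mV A)%E.
Proof. by move=> mA; rewrite mul1e lebesgue_tuple_translation. Qed.

Lemma integrable_translate a F : mV.-integrable setT (EFin \o (F \o oV)) ->
  mV.-integrable setT (EFin \o (fun c => F (oV c - a))).
Proof.
move=> Fi; have := integrable_transfer (mshift (- a)) ltr01 (@shift_transfer _) Fi.
by congr (_.-integrable _ _); apply/funext => c /=; rewrite shiftE addrC.
Qed.

Lemma Rintegral_translate a F : mV.-integrable setT (EFin \o (F \o oV)) ->
  \int[mV]_c F (oV c - a) = \int[mV]_c F (oV c).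
Proof.
move=> Fi; have /= -> := Rintegral_transfer (mshift (- a)) ltr01 (@shift_transfer _) Fi.
by rewrite mul1r; apply: eq_Rintegral => c _; rewrite shiftE addrC.
Qed.

Lemma ae_translate a (P : V -> Prop) : {ae mV, forall c, P (oV c)} ->
  {ae mV, forall c, P (oV c - a)}.
Proof.
move=> [N [mN N0 sN]]; exists (shift (- a) @^-1` N); split.
- exact: measurable_preimage.
- by rewrite -[RHS]N0 -[RHS](shift_transfer (- a))// mul1e.
- by move=> c /= Pc; apply: sN => /=; rewrite shiftE addrC.
Qed.

(** This transports the equality of f with its Borel representative from V to almost every slice H_e
    - t a. *)
Lemma ae_sweep e a (P : V -> Prop) : dot e e = 1 -> dot a e != 0 ->
  {ae mV, forall c, P (oV c)} ->
  {ae leb, forall t, {ae mu (hyperplane dot e), forall c, P (of_coord dot c - t *: a)}}.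
Proof.
move=> e1 ae [N [mN N0 sN]].
pose A := coords dot (onbasis dot fullv) @^-1` N.
have AE : oV @^-1` A = N.
  by apply/seteqP; split => c; rewrite /A /preimage/= (lincombK (onbasisP dot fullv)).
have [||mS S0] := @null_sweep e a A e1 ae; rewrite ?AE//.
apply: filterS (ae_slice mS S0) => t [mx x0]; exists (xsection (@sweep e a @^-1` A) t).
split => // c /= Pc; rewrite /xsection/= inE /preimage/= /A /preimage/=.
apply: sN => /= Pc'; apply: Pc; move: Pc'.
by rewrite [oV _](coordsK (onbasisP dot fullv) (memvf _)).
Qed.

End SweepIntegral.

(** * The increment of a product of step functions under x |-> x + a, and its integral *)

Section StepProduct.
Context {R : realType} {V : vectType R}.
Variable dot : {dot V for idfun}.
Local Notation Rm := (measurableTypeR R).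
Local Notation leb := (@lebesgue_measure R).
Local Notation mu X := (@lebesgue_tuple R (\dim X)).
Local Notation mV := (@lebesgue_tuple R (\dim {:V})).
Local Notation oV := (@of_coord R V dot fullv).
Implicit Types (u v e a x : V) (F p q : V -> R) (s : seq V).

(** With y and z in {0, 1} this gives indicators of half-lines, with 1 and -1 the sign. The value 0
    at 0 makes [stepprod] vanish on the hyperplanes, as open chambers require. *)
Definition step (y z r : R) : R := if 0 < r then y else if r < 0 then z else 0.

Definition stepprod s p q x : R := \prod_(e <- s) step (p e) (q e) (dot e x).

Definition others s e := [seq f <- s | f != e].

Lemma normr_step y z r : `|y| <= 1 -> `|z| <= 1 -> `|step y z r| <= 1.
Proof. by move=> y1 z1; rewrite /step; case: ifP => // _; case: ifP; rewrite ?normr0. Qed.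

Lemma normr_stepprod s p q x : (forall e, `|p e| <= 1) -> (forall e, `|q e| <= 1) ->
  `|stepprod s p q x| <= 1.
Proof.
move=> p1 q1; rewrite /stepprod normr_prod.
elim: s => [|e s IH]; first by rewrite big_nil.
rewrite big_cons; apply: mulr_ile1 => //; last exact: normr_step.
by apply: prodr_ge0 => f _; exact: normr_ge0.
Qed.

Lemma measurable_step y z : measurable_fun setT (step y z).
Proof.
rewrite /step; apply: measurable_fun_ifT => //; first exact: measurable_fun_ltr.
by apply: measurable_fun_ifT => //; exact: measurable_fun_ltr.
Qed.

Lemma measurable_stepprod d (T : measurableType d) s p q (g : T -> V) :
  (forall v, measurable_fun setT (fun t => dot v (g t) : R)) ->
  measurable_fun setT (fun t => stepprod s p q (g t)).
Proof.
move=> mg; apply: measurable_prod => e _.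
exact: measurableT_comp (@measurable_step _ _) (mg e).
Qed.

(** The t for which x + t a lies on H_e. It has no meaning if (e, a) = 0, a case that is split off
    wherever it is used. *)
Definition crossing_time e a x : R := - dot e x / dot e a.

(** The other factors at the moment when the path meets H_e. The closed interval matches the domain
    of the t-integral; for generic x no crossing happens at an end. *)
Definition crossing s p q a e x : R :=
  if 0 <= crossing_time e a x <= 1
  then stepprod (others s e) p q (x + crossing_time e a x *: a) else 0.

(** The last hypothesis says that crossing times differ: those of e and f agree exactly when x is
    orthogonal to (f, a) e - (e, a) f. The values [A e] before and [B e] after the jump are [q e]
    and [p e] if (e, a) > 0 and swapped if (e, a) < 0, whence the factor [Num.sg]. *)
Lemma stepprodB s p q a x : uniq s ->
  (forall e, e \in s -> dot e x != 0 /\ dot e (x + a) != 0) ->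
  (forall e f, e \in s -> f \in s -> e != f -> dot e a != 0 -> dot f a != 0 ->
     dot (dot f a *: e - dot e a *: f) x != 0) ->
  stepprod s p q (x + a) - stepprod s p q x =
  \sum_(e <- s) (if dot e a == 0 then 0
     else Num.sg (dot e a) * (p e - q e) * crossing s p q a e x).
Proof.
move=> us Hx Hd.
pose h e t := step (p e) (q e) (dot e (x + t *: a)).
pose A e := if 0 < dot e a then q e else if dot e a < 0 then p e
            else step (p e) (q e) (dot e x).
pose B e := if 0 < dot e a then p e else if dot e a < 0 then q e
            else step (p e) (q e) (dot e x).
have hE e t : dot e a != 0 -> dot e (x + t *: a) = dot e a * (t - crossing_time e a x).
  move=> ea; rewrite linearDr/= dotZr mulrBr /crossing_time mulrCA divff// mulr1.
  by rewrite opprK addrC [t * _]mulrC.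
have := @step_product_telescope R V s (fun e => dot e a != 0)
  (fun e => crossing_time e a x) A B h 0 1 us ler01.
rewrite /stepprod => H; have {}H := H _ _ _ _ _.
transitivity (\prod_(i <- s) h i 1 - \prod_(i <- s) h i 0).
  by congr (_ - _); apply: eq_bigr => e _; rewrite /h ?scale1r// scale0r addr0.
rewrite H.
- rewrite big_mkcond big_seq [RHS]big_seq; apply: eq_bigr => e es.
  have [//|ea] := eqVneq (dot e a) 0 => /=.
  have [x0 xa0] := Hx e es.
  have t0 : crossing_time e a x != 0.
    by rewrite /crossing_time mulf_neq0 ?invr_eq0// oppr_eq0.
  have t1 : crossing_time e a x != 1.
    apply: contraNneq xa0 => t1; have := hE e 1 ea; rewrite scale1r t1 subrr mulr0.
    by move=> ->.
  rewrite /crossing !le_eqVlt [0 == _]eq_sym (negPf t0) (negPf t1)/=.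
  case: ifP => _; last by rewrite mulr0.
  rewrite /stepprod /others big_filter; congr (_ * _).
  rewrite /A /B; have [lt|lt|] := ltgtP (dot e a) 0.
  + by rewrite ltr0_sg// mulN1r opprB.
  + by rewrite gtr0_sg// mul1r.
  + by move=> e0; rewrite e0 eqxx in ea.
- move=> e es /negPn /eqP e0 t; rewrite /h /A e0 ltxx linearDr/= dotZr e0.
  by rewrite mulr0 addr0.
- move=> e t es ea lt; rewrite /h hE// /A /step.
  have tn : t - crossing_time e a x < 0 by rewrite subr_lt0.
  have [lt0|lt0|] := ltgtP (dot e a) 0.
  + by rewrite nmulr_rgt0// tn.
  + by rewrite pmulr_rgt0// pmulr_rlt0// tn ltNge (ltW tn).
  + by move=> e0; rewrite e0 eqxx in ea.
- move=> e t es ea lt; rewrite /h hE// /B /step.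
  have tn : 0 < t - crossing_time e a x by rewrite subr_gt0.
  have [lt0|lt0|] := ltgtP (dot e a) 0.
  + by rewrite nmulr_rgt0// nmulr_rlt0// tn ltNge (ltW tn).
  + by rewrite pmulr_rgt0// tn.
  + by move=> e0; rewrite e0 eqxx in ea.
- move=> e f es fs ea fa ef; apply: contraNneq (Hd e f es fs ef ea fa) => tef.
  rewrite linearBl/= !dotZl; move: tef; rewrite /crossing_time => /eqP.
  rewrite !mulNr eqr_opp eqr_div// => /eqP E.
  by rewrite mulrC E mulrC subrr.
- move=> e es ea; have [x0 xa0] := Hx e es; split.
    by rewrite /crossing_time mulf_neq0 ?invr_eq0// oppr_eq0.
  apply: contraNneq xa0 => t1; have := hE e 1 ea; rewrite scale1r t1 subrr mulr0.
  by move=> ->.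
Qed.

Section Main.
Variables (s : seq V) (p q : V -> R) (F : V -> R) (a : V).
Hypotheses (us : uniq s) (s1 : forall e, e \in s -> dot e e = 1).
Hypothesis s_free : forall e f, e \in s -> f \in s -> e != f -> free [:: e; f].
Hypotheses (p1 : forall e, `|p e| <= 1) (q1 : forall e, `|q e| <= 1).
Hypothesis Fi : mV.-integrable setT (EFin \o (F \o oV)).

Let ae_generic : {ae mV, forall c,
  (forall e, e \in s -> dot e (oV c) != 0 /\ dot e (oV c + a) != 0) /\
  (forall e f, e \in s -> f \in s -> e != f -> dot e a != 0 -> dot f a != 0 ->
     dot (dot f a *: e - dot e a *: f) (oV c) != 0)}.
Proof.
have ae_seq (l : seq V) (P : V -> (\dim {:V}).-tuple Rm -> Prop) :
    (forall e, e \in l -> {ae mV, forall c, P e c}) ->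
    {ae mV, forall c, forall e, e \in l -> P e c}.
  elim: l => [|e l IH] H; first by apply: filterE.
  have He := H e (mem_head _ _).
  have Hl := IH (fun f fl => H f (mem_behead (fl : f \in behead (e :: l)))).
  apply: filterS2 He Hl => c Pe Pl f; rewrite inE => /predU1P[->//|]; exact: Pl.
have e_neq0 e : e \in s -> e != 0.
  by move=> /s1 e1; apply: contra_eq_neq e1 => ->; rewrite linear0r eq_sym oner_eq0.
apply: filterS2 (_ : {ae mV, forall c, forall e, e \in s ->
    dot e (oV c) != 0 /\ dot e (oV c + a) != 0}) (_ : {ae mV, forall c, forall e,
    e \in s -> forall f, f \in s -> e != f -> dot e a != 0 -> dot f a != 0 ->
    dot (dot f a *: e - dot e a *: f) (oV c) != 0}).
- by move=> c H1 H2; split => // e f es fs; exact: H2.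
- apply: (ae_seq _ _) => e es; have H0 := ae_neq_affine dot 0 (e_neq0 e es).
  have Ha := ae_neq_affine dot (- dot e a) (e_neq0 e es).
  apply: filterS2 H0 Ha => c c0 ca; split => //.
  by rewrite linearDr/= addr_eq0.
- apply: (ae_seq _ _) => e es; apply: (ae_seq _ _) => f fs.
  have [->|ef] := eqVneq e f; first by apply: filterE.
  have [ea|ea] := eqVneq (dot e a) 0; first by apply: filterE.
  have [fa|fa] := eqVneq (dot f a) 0; first by apply: filterE.
  (* Linear independence of e and f makes the set of points with coinciding crossing times a proper
     hyperplane, hence null. *)
  have v0 : dot f a *: e - dot e a *: f != 0.
    have := s_free es fs ef; rewrite free_cons seq1_free => /andP[eNf f0].
    apply: contraNneq eNf => /eqP; rewrite subr_eq0 => /eqP E.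
    rewrite span_seq1; apply/vlineP; exists ((dot f a)^-1 * dot e a).
    by rewrite -scalerA -E scalerA mulVf// scale1r.
  by apply: filterS (ae_neq_affine dot 0 v0) => c.
Qed.

Let mcrossing e : dot e a != 0 ->
  measurable_fun setT (fun c => crossing s p q a e (oV c)).
Proof.
move=> ea; rewrite /crossing.
have mt : measurable_fun setT (fun c => crossing_time e a (oV c)).
  apply: measurable_funM => //; apply: measurableT_comp; first exact: oppr_measurable.
  exact: measurable_dot_of_coord.
apply: measurable_fun_ifT => //.
  by apply: measurable_and; apply: measurable_fun_ler.
apply: measurable_stepprod => v.
rewrite (_ : (fun c => _) = fun c => dot v (oV c) + crossing_time e a (oV c) * dot v a).
  apply: measurable_realfun.measurable_funD; first exact: measurable_dot_of_coord.
  exact: measurable_funM.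
by apply/funext => c; rewrite linearDr/= dotZr.
Qed.

Let normr_crossing e x : `|crossing s p q a e x| <= 1.
Proof. by rewrite /crossing; case: ifP => _; rewrite ?normr0// normr_stepprod. Qed.

Let Rintegral_crossing e : e \in s -> dot e a != 0 ->
  \int[mV]_c (F (oV c) * crossing s p q a e (oV c)) =
  `|dot e a| * \int[leb]_(t in `[0, 1])
     \int[mu (hyperplane dot e)]_c
        (F (of_coord dot c - (t : R) *: a) * stepprod (others s e) p q (of_coord dot c)).
Proof.
move=> es ea; have e1 := s1 es; have ae : dot a e != 0 by rewrite dotC.
have Ci : mV.-integrable setT (EFin \o ((fun x => F x * crossing s p q a e x) \o oV)).
  exact: integrable_bounded (mcrossing ea) (fun c => normr_crossing e _) Fi.
rewrite (@Rintegral_sweep _ _ _ e a (fun x => F x * crossing s p q a e x))//.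
rewrite dotC; congr (_ * _).
rewrite (Rintegral_prod (integrable_sweep e1 ae Ci)).
rewrite [RHS]Rintegral_mkcond; apply: eq_Rintegral => t _ /=.
(* The point y - t a with y in H_e meets H_e at time t, in y. So the crossing time is the sweep
   parameter, and the remaining factors are evaluated at y. *)
have ctE c : crossing_time e a (@sweep R V dot e a (t, c)) = t.
  rewrite /crossing_time /sweep/= dotBZ (_ : dot e _ = 0) ?sub0r ?opprK ?mulfK//.
  by apply/eqP; rewrite -mem_hyperplane; exact: lincomb_mem (onbasisP dot _).
rewrite patchE; case: ifPn; rewrite ?inE ?notin_setE/= in_itv/=.
  move=> t01; apply: eq_Rintegral => c _; rewrite /crossing ctE t01.
  by rewrite /sweep/= subrK.
move=> /negP t01; under eq_Rintegral do rewrite /crossing ctE (negPf t01) mulr0.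
by rewrite /Rintegral integral0.
Qed.

(** The sign of (e, a) in each jump and the Jacobian |(e, a)| of the sweep combine to the factor (a,
    e). *)
Lemma Rintegral_stepprodB :
  \int[mV]_c (F (oV c) * (stepprod s p q (oV c + a) - stepprod s p q (oV c))) =
  \sum_(e <- s) (p e - q e) * dot a e * \int[leb]_(t in `[0, 1])
     \int[mu (hyperplane dot e)]_c
        (F (of_coord dot c - (t : R) *: a) * stepprod (others s e) p q (of_coord dot c)).
Proof.
pose G e c := if (e \in s) && (dot e a != 0)
  then F (oV c) * (Num.sg (dot e a) * (p e - q e) * crossing s p q a e (oV c)) else 0.
have Gi e : mV.-integrable setT (EFin \o G e).
  have [/andP[es ea]|H] := boolP ((e \in s) && (dot e a != 0)); last first.
    by rewrite /G (negPf H); exact: integrable0.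
  rewrite /G es ea/=.
  apply: (@integrable_bounded _ _ _ _ _ _ `|Num.sg (dot e a) * (p e - q e)|) Fi => [|c].
    by apply: measurable_funM => //; exact: mcrossing.
  by rewrite normrM ler_piMr.
transitivity (\int[mV]_c (\sum_(e <- s) G e c)).
  apply: Rintegral_ae; apply: filterS ae_generic => c [H1 H2] _.
  rewrite stepprodB// mulr_sumr big_seq [RHS]big_seq; apply: eq_bigr => e es.
  by rewrite /G es/=; case: eqVneq => //=; rewrite mulr0.
rewrite Rintegral_sum//; rewrite big_seq [RHS]big_seq; apply: eq_bigr => e es.
rewrite /G es/=; have [ea|ea] := eqVneq (dot e a) 0 => /=.
  by rewrite /Rintegral integral0 [dot a e]dotC ea mulr0 mul0r.
rewrite (@eq_Rintegral _ _ _ _ _ (fun c => (Num.sg (dot e a) * (p e - q e)) *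
    (F (oV c) * crossing s p q a e (oV c)))); last by move=> c _; rewrite mulrCA.
rewrite RintegralZl//; last first.
  exact: integrable_bounded (mcrossing ea) (fun c => normr_crossing e _) Fi.
rewrite Rintegral_crossing// !mulrA; congr (_ * _).
by rewrite mulrAC -numEsg [dot a e]dotC mulrC.
Qed.

End Main.

End StepProduct.

(** * Chambers as sets of points with prescribed signs *)

Section Chambers.
Context {R : realType} {V : vectType R}.
Variable dot : {dot V for idfun}.
Implicit Types (X H : {vspace V}) (AA : {fset {vspace V}}) (s : seq V).
Implicit Types (u v x y z f e : V) (Z : set V).

Local Notation compl X AA := (@arrangement_compl R V dot X AA).

Lemma dot_le_enorm u v : `|dot u v| <= enorm dot u * enorm dot v.
Proof.
rewrite -(@ler_pXn2r _ 2)// ?nnegrE ?mulr_ge0 ?sqrtr_ge0//.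
rewrite exprMn !sqr_sqrtr ?dot_ge0// real_normK ?num_real//.
exact: dot_cauchy_schwarz.
Qed.

Lemma continuous_dot v : continuous (fun x : euclidean dot => dot v x : R).
Proof.
move=> x; apply/(@cvgrPdist_lt _ _ _ (nbhs (x : euclidean dot)) _
  (fun x => dot v x : R^o)) => eps e0; near=> y.
have v0 : 0 < enorm dot v + 1 by rewrite ltr_pwDr ?sqrtr_ge0.
rewrite -linearBr/=; apply: le_lt_trans (dot_le_enorm _ _) _.
apply: (@le_lt_trans _ _ ((enorm dot v + 1) * enorm dot (x - y))).
  by rewrite ler_wpM2r ?sqrtr_ge0// lerDl.
rewrite mulrC -ltr_pdivlMr//.
near: y; apply: (@cvgr_dist_lt _ _ _ (nbhs x) _ id x); first exact: cvg_id.
by rewrite divr_gt0// ltr_wpDl ?sqrtr_ge0.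
Unshelve. all: by end_near. Qed.

(** If X contains x and x lies on no hyperplane, this is the chamber of x. It is also used with X =
    H_e and x in a chamber T of V: then it is the facet of T on H_e, or empty. *)
Definition region X s x : set V :=
  [set y | y \in X /\ forall f, f \in s -> 0 < dot f x * dot f y].

(** Several normals f can cut out the same subspace of H_e, so a restricted arrangement is not
    indexed by normals. This relation keeps what chambers depend on, the complement of the
    arrangement. *)
Definition presents X AA s := forall x, x \in X ->
  (forall H, H \in AA -> x \notin H) <-> (forall f, f \in s -> dot f x != 0).

Lemma region_refl X s x : x \in X -> (forall f, f \in s -> dot f x != 0) ->
  region X s x x.
Proof. by move=> xX sx; split => // f fs; rewrite -expr2 exprn_even_gt0/= ?sx. Qed.

Lemma region_neq0 X s x y : region X s x y ->
  forall f, f \in s -> dot f x != 0 /\ dot f y != 0.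
Proof.
move=> [_ H] f /H; case: (eqVneq (dot f x) 0) => [->|fx]; first by rewrite mul0r ltxx.
by case: (eqVneq (dot f y) 0) => [->|//]; rewrite mulr0 ltxx.
Qed.

Lemma mulr_gt0_sg (a b : R) : (0 < a * b) = (a != 0) && (Num.sg a == Num.sg b).
Proof.
case: (ltgtP a 0) => [a0|a0|->]; last by rewrite mul0r ltxx.
- rewrite nmulr_rgt0//= ltr0_sg//.
  by case: (ltgtP b 0) => [b0|b0|->]; rewrite ?(ltr0_sg b0) ?(gtr0_sg b0) ?sgr0 ?eqxx//;
    apply/esym/eqP; lra.
- rewrite pmulr_rgt0//= gtr0_sg//.
  by case: (ltgtP b 0) => [b0|b0|->]; rewrite ?(ltr0_sg b0) ?(gtr0_sg b0) ?sgr0 ?eqxx//;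
    apply/esym/eqP; lra.
Qed.

Lemma region_sg X s x y : region X s x y ->
  forall f, f \in s -> Num.sg (dot f x) = Num.sg (dot f y).
Proof. by move=> [_ H] f /H; rewrite mulr_gt0_sg => /andP[_ /eqP]. Qed.

Lemma region_eq X s x y : x \in X -> region X s x y -> region X s x = region X s y.
Proof.
move=> xX xy; have [yX _] := xy; apply/seteqP; split => z [zX H]; split => // f fs.
  have := H f fs; rewrite !mulr_gt0_sg (region_sg xy fs) => /andP[_ ->].
  by have [_ ->] := region_neq0 xy fs.
have := H f fs; rewrite !mulr_gt0_sg (region_sg xy fs) => /andP[_ ->].
by have [->] := region_neq0 xy fs.
Qed.

(** On a component each (f, .) is continuous without zeros, so its sign is constant by the
    intermediate value property. Conversely a region is convex, and the segment from x to y stays in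
    the complement. *)
Lemma component_region X AA s x : presents X AA s ->
  compl X AA x ->
  connected_component (compl X AA) x = region X s x.
Proof.
move=> ps [xX xA]; have xs := (ps x xX).1 xA.
apply/seteqP; split => y.
- have cP := @component_connected _ (compl X AA) (x : euclidean dot).
  have sub := @connected_component_sub _ (compl X AA) (x : euclidean dot).
  move=> Cy; have [yX yA] := sub _ Cy; split => // f fs.
  have fy := (ps y yX).1 yA f fs.
  have Cx : connected_component (compl X AA) (x : euclidean dot) x.
    exact: connected_component_refl.
  have /connected_intervalP itv := connected_continuous_connected cP
    (continuous_subspaceT (@continuous_dot f)).
  rewrite ltNge; apply/negP => xy.
  have [z Cz z0] : ((fun x : euclidean dot => dot f x : R) @`
      connected_component (compl X AA) (x : euclidean dot)) 0.
    have [fx0|fx0] := leP (dot f x) 0.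
      apply: (itv (dot f x) (dot f y)); [by exists x|by exists y|].
      rewrite fx0/=; move: xy; rewrite nmulr_rle0//.
      by rewrite lt_neqAle fx0 xs.
    apply: (itv (dot f y) (dot f x)); [by exists y|by exists x|].
    by rewrite (ltW fx0) andbT; move: xy; rewrite pmulr_rle0.
  have [zX zA] := sub _ Cz.
  by have := (ps z zX).1 zA f fs; rewrite z0 eqxx.
- move=> [yX yP].
  pose g (t : R) : euclidean dot := (x : euclidean dot) + t *: ((y : euclidean dot) - x).
  have cg : continuous g.
    move=> t; apply: cvgD; first exact: cvg_cst.
    by apply: cvgZr_tmp; exact: cvg_id.
  apply: (@connected_component_max _ _ (g @` `[0, 1])).
  + by exists 0; rewrite /= ?in_itv/= ?lexx ?ler01// /g scale0r addr0.
  + move=> z [t /= t01 <-]; move: t01; rewrite in_itv/= => /andP[t0 t1].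
    have gX : (g t : V) \in X by rewrite memvD// memvZ// memvB.
    split => //; apply/(ps _ gX) => f fs.
    have fx := xs f fs; have fxy := yP f fs.
    have : 0 < dot f x * dot f (g t : V).
      have -> : dot f (g t : V) = (1 - t) * dot f x + t * dot f y.
        by rewrite /g linearDr/= dotZr linearBr/=; ring.
      have fxx : 0 < dot f x * dot f x by rewrite -expr2 exprn_even_gt0.
      rewrite mulrDr ![dot f x * (_ * _)]mulrCA; have [t_gt0|t_le0] := ltP 0 t.
        apply: ltr_wpDl; last exact: mulr_gt0.
        by apply: mulr_ge0; [rewrite subr_ge0|exact: ltW].
      have -> : t = 0 by apply/le_anti; rewrite t0 t_le0.
      by rewrite subr0 mul1r mul0r addr0.
    by apply: contraTneq => ->; rewrite mulr0 ltxx.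
  + apply: connected_continuous_connected; first exact: segment_connected.
    exact: continuous_subspaceT.
  + by exists 1; rewrite /= ?in_itv/= ?lexx ?ler01// /g scale1r addrC subrK.
Qed.

Lemma chambersP X AA s Z : presents X AA s ->
  chambers dot X AA Z <->
  exists x, [/\ x \in X, forall f, f \in s -> dot f x != 0 & Z = region X s x].
Proof.
move=> ps; split => [[x xc <-]|[x [xX xs ->]]].
  have [xX xA] := xc; exists x; split => //; first exact/(ps x xX).
  exact: component_region.
have xc : compl X AA x by split => //; exact/(ps x xX).
by exists x => //; exact: component_region.
Qed.

Lemma finite_chambers X AA s : presents X AA s -> finite_set (chambers dot X AA).
Proof.
move=> ps.
pose T (I : {set seq_sub s}) := [set y | y \in X /\
  forall f : seq_sub s, if f \in I then 0 < dot (val f) y else dot (val f) y < 0].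
apply: (@sub_finite_set _ _ (T @` setT)); last exact/finite_image/finite_finset.
move=> Z /(chambersP _ ps)[x [xX xs ->]].
exists [set f : seq_sub s | 0 < dot (val f) x]%SET => //.
apply/seteqP; split => y [yX H]; split => //.
- move=> f fs; have := H (SeqSub fs); rewrite inE/=.
  have := xs f fs; case: (ltgtP (dot f x) 0) => //= fx _ fy.
    by rewrite nmulr_rgt0.
  by rewrite pmulr_rgt0.
- move=> [f fs]; rewrite inE/=; have := H f fs; have := xs f fs.
  case: (ltgtP (dot f x) 0) => //= fx _; first by rewrite nmulr_rgt0.
  by rewrite pmulr_rgt0.
Qed.

(** [component_region] for the arrangement {H}, presented by the single normal f, turns separation
    by H into opposite signs of f. *)
Lemma separatesP X H s f x y : (forall z, z \in X -> (z \notin H) = (dot f z != 0)) ->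
  f \in s -> x \in X -> y \in X ->
  (forall g, g \in s -> dot g x != 0) -> (forall g, g \in s -> dot g y != 0) ->
  separates dot X H (region X s x) (region X s y) <-> dot f x * dot f y < 0.
Proof.
move=> HP fs xX yX xs ys.
have ps : presents X [fset H]%fset [:: f].
  move=> z zX; split => [zH g|zf K].
    by rewrite inE => /eqP ->; rewrite -HP// zH// inE.
  by rewrite inE => /eqP ->; rewrite HP// zf// inE.
have comp z : z \in X -> dot f z != 0 ->
    connected_component (compl X [fset H]%fset) z = region X [:: f] z.
  move=> zX fz; apply: component_region => //; split => // K.
  by rewrite inE => /eqP ->; rewrite HP.
split.
- move=> /(_ x y (region_refl xX xs) (region_refl yX ys)).
  rewrite comp ?xs// => nr; rewrite ltNge le_eqVlt negb_or eq_sym mulf_neq0 ?xs ?ys//=.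
  by apply/negP => xy; apply: nr; split => // g; rewrite inE => /eqP ->.
- move=> xy z w zx wy; have [zX _] := zx; have [_ fz] := region_neq0 zx fs.
  rewrite comp// => -[_ /(_ f (mem_head _ _))]; move: xy.
  rewrite !mulr_gt0_sg fz/= -(region_sg zx fs) -(region_sg wy fs) => xy /eqP E.
  have : 0 < dot f x * dot f y by rewrite mulr_gt0_sg xs//= E.
  by rewrite ltNge (ltW xy).
Qed.

Lemma near_same_sign s x v : \forall eps \near (0 : R)^'+,
  forall f, f \in s -> dot f x != 0 -> 0 < dot f x * dot f (x + eps *: v).
Proof.
elim: s => [|f s IH]; first by apply: nearW.
suff H : \forall eps \near (0 : R)^'+, dot f x != 0 -> 0 < dot f x * dot f (x + eps *: v).
  by apply: filterS2 H IH => eps H1 H2 g; rewrite inE => /predU1P[->|/H2].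
have [fx|fx] := eqVneq (dot f x) 0; first exact: nearW.
near=> eps => _; rewrite linearDr/= dotZr mulrDr.
have fxx : 0 < dot f x * dot f x by rewrite -expr2 exprn_even_gt0.
set c := dot f x * (_ * _).
suff : `|c| < dot f x * dot f x by rewrite ltr_norml => /andP[]; lra.
rewrite /c mulrCA normrM.
have eps0 : 0 < eps by near: eps; exact: nbhs_right_gt.
rewrite gtr0_norm//.
(* Adding 1 keeps the divisor positive when (f, x)(f, v) = 0. *)
apply: (@le_lt_trans _ _ (eps * (`|dot f x * dot f v| + 1))).
  by rewrite ler_wpM2l ?(ltW eps0)// lerDl.
rewrite -ltr_pdivlMr ?ltr_pwDr//.
near: eps; apply: nbhs_right_lt; apply: divr_gt0; last by rewrite ltr_wpDl.
by rewrite -expr2 exprn_even_gt0.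
Unshelve. all: by end_near. Qed.

End Chambers.

(** * Chamber signs as products over normals; parity of intersection multiplicities *)

Section Signs.
Context {R : realType} {V : vectType R}.
Variables (dot : {dot V for idfun}) (E : {fset V}).
Hypothesis E_unit : forall e, e \in E -> dot e e = 1.
Hypothesis E_indep : forall e f, e \in E -> f \in E -> e != f -> free [:: e; f].
Implicit Types (X H W : {vspace V}) (AA : {fset {vspace V}}) (e f u v x y z : V) (Z : set V).
Local Notation Hyp := (hyperplane dot).

Lemma mem_others e f : (f \in others E e) = (f != e) && (f \in E).
Proof. by rewrite /others mem_filter. Qed.

(** The witness is the projection v of f to H_e. Were it also orthogonal to f, then (v, v) = (f, v)
    - (e, f)(e, v) would vanish and f would be a multiple of e. *)
Lemma hyperplane_witness e f : e \in E -> f \in E -> e != f ->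
  exists v, [/\ v \in Hyp e, v \notin Hyp f & v = f - dot e f *: e].
Proof.
move=> eE fE ef; pose v := f - dot e f *: e; exists v.
have ev : dot e v = 0 by rewrite dotBZ E_unit// mulr1 subrr.
split => //; rewrite mem_hyperplane; first exact/eqP.
apply/eqP => fv; have : free [:: f; e] by apply: E_indep => //; rewrite eq_sym.
rewrite free_cons span_seq1 => /andP[/vlineP fNe _]; apply: fNe.
exists (dot e f); apply/eqP; rewrite -subr_eq0 -/v; apply/negPn/negP => v0.
have : 0 < dot v v by exact: neq0_dnorm_gt0.
have -> : dot v v = dot f v - dot e f * dot e v by rewrite {1}/v linearBl/= dotZl.
by rewrite ev fv mulr0 subrr ltxx.
Qed.

Lemma hyperplane_inj : {in E &, injective Hyp}.
Proof.
move=> e f eE fE ef; apply/eqP/negPn/negP => /(hyperplane_witness eE fE)[v []].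
by rewrite ef => ->.
Qed.

Lemma presents_arrangement : presents dot fullv (arrangement dot E) E.
Proof.
move=> x _; split => [H f fE|H W].
  by rewrite -mem_hyperplane; apply: H; exact: in_imfset.
by move=> /imfsetP[f /= fE ->]; rewrite mem_hyperplane; exact: H.
Qed.

Let cap_notin e f x : x \in Hyp e -> (x \notin (Hyp e :&: Hyp f)%VS) = (dot f x != 0).
Proof. by move=> xe; rewrite memv_cap xe/= mem_hyperplane. Qed.

Lemma presents_restricted e : presents dot (Hyp e) (restricted dot E e) (others E e).
Proof.
move=> x xe; split => [H f|H W].
  rewrite mem_others => /andP[fe fE]; rewrite -(cap_notin _ xe); apply: H.
  by apply/imfsetP; exists f => //=; rewrite inE fE.
move=> /imfsetP[f /=]; rewrite inE => /andP[fE fe] ->.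
by rewrite cap_notin//; apply: H; rewrite mem_others fe.
Qed.

Definition even_others e :=
  [seq f <- E | (f != e) && ~~ odd (multiplicity dot E (Hyp e :&: Hyp f))].

Lemma mem_even_others e f : (f \in even_others e) =
  [&& f != e, ~~ odd (multiplicity dot E (Hyp e :&: Hyp f)) & f \in E].
Proof. by rewrite /even_others mem_filter -andbA. Qed.

Lemma presents_even_restricted e :
  presents dot (Hyp e) (even_restricted dot E e) (even_others e).
Proof.
move=> x xe; split => [H f|H W].
  rewrite mem_even_others => /and3P[fe fo fE]; rewrite -(cap_notin _ xe); apply: H.
  by apply/imfsetP; exists f => //=; rewrite inE fE fe.
move=> /imfsetP[f /=]; rewrite inE => /and3P[fE fe fo] ->.
by rewrite cap_notin//; apply: H; rewrite mem_even_others fe fo.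
Qed.

Definition flip X Z0 Z H : R := if `[< separates dot X H Z0 Z >] then -1 else 1.

Lemma chamber_signE X AA Z0 Z :
  chamber_sign dot X AA Z0 Z = (\prod_(H <- AA) flip X Z0 Z H)%:C%C.
Proof.
rewrite /chamber_sign card_fset_sum1.
rewrite (big_morph (fun k => (-1) ^+ k) (exprD (-1 : R[i])) (expr0 _)).
rewrite big_fset/= rmorph_prod big_mkcond/=; apply: eq_bigr => H _.
by rewrite /flip; case: ifP => _; rewrite ?rmorph1// rmorphN1 expr1.
Qed.

Lemma flipE X H s f x y : (forall z, z \in X -> (z \notin H) = (dot f z != 0)) ->
  f \in s -> x \in X -> y \in X ->
  (forall g, g \in s -> dot g x != 0) -> (forall g, g \in s -> dot g y != 0) ->
  flip X (region dot X s x) (region dot X s y) H = Num.sg (dot f x) * Num.sg (dot f y).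
Proof.
move=> HP fs xX yX xs ys; have := separatesP HP fs xX yX xs ys.
rewrite /flip -sgrM; case: asboolP => sep [h1 h2].
  by rewrite ltr0_sg//; exact: h1.
rewrite gtr0_sg// ltNge le_eqVlt negb_or mulf_neq0 ?xs ?ys//=.
by apply/negP => /h2.
Qed.

(** Distinct normals have distinct hyperplanes, so the product over the arrangement is a product
    over E; as x is positive on every normal, only the signs of z remain. *)
Lemma base_signE x z : (forall f, f \in E -> 0 < dot f x) ->
  (forall f, f \in E -> dot f z != 0) ->
  base_sign dot E (region dot fullv E x) (region dot fullv E z) =
  (\prod_(f <- E) Num.sg (dot f z))%:C%C.
Proof.
move=> x0 zE; rewrite /base_sign chamber_signE /arrangement; congr (_%:C)%C.
rewrite big_imfset/=; last exact: hyperplane_inj.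
rewrite big_seq [RHS]big_seq; apply: eq_bigr => f fE.
rewrite (@flipE _ _ (enum_fset E) f)//; rewrite ?memvf//.
- by rewrite gtr0_sg ?mul1r// x0.
- by move=> w _; rewrite mem_hyperplane.
- by move=> g gE; rewrite gt_eqF// x0.
Qed.

Lemma dim_cap_hyperplane e f : e \in E -> f \in E -> e != f ->
  \dim (Hyp e :&: Hyp f) = (\dim (Hyp e)).-1.
Proof.
move=> eE fE ef; rewrite [RHS](@eq_dim_orthov1 _ _ _ _ dot f)//.
have [v [ve vf _]] := hyperplane_witness eE fE ef.
apply/mem_orthovPn; exists v => //; move: vf; rewrite mem_hyperplane.
by apply: contra => /eqP H; apply/eqP.
Qed.

(** Both intersections have codimension 1 in H_e, so an inclusion between them is an equality. *)
Lemma cap_hyperplane_eq e f g : e \in E -> f \in E -> g \in E -> f != e -> g != e ->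
  ((Hyp e :&: Hyp g) <= Hyp f)%VS = ((Hyp e :&: Hyp f)%VS == (Hyp e :&: Hyp g)%VS).
Proof.
move=> eE fE gE fe ge; apply/idP/eqP => [H|<-]; last exact: capvSr.
apply/esym/eqP; rewrite eqEdim subv_cap capvSl H/=.
by rewrite !dim_cap_hyperplane// eq_sym.
Qed.

(** The successor counts e. Thus the fibre of f |-> H_e /\ H_f over a subspace has one element less
    than its multiplicity, an odd number exactly when the multiplicity is even. *)
Lemma multiplicityE e g : e \in E -> g \in E -> g != e ->
  multiplicity dot E (Hyp e :&: Hyp g) =
  #|` [fset f in [fset f in E | f != e] | (Hyp e :&: Hyp f)%VS == (Hyp e :&: Hyp g)%VS]%fset |.+1.
Proof.
move=> eE gE ge; rewrite /multiplicity.
set A := [fset f in [fset f in E | f != e] | _]%fset.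
have eA : e \notin A by rewrite !inE eqxx andbF.
rewrite -[RHS]add1n -(cardfs1 e) -cardfsUI.
have -> : ([fset e] `&` A = fset0)%fset.
  by apply/fsetP => f; rewrite !inE; case: eqVneq => [->|]//=; rewrite ?eqxx ?andbF.
rewrite cardfs0 addn0; congr #|` _|; apply/fsetP => f.
rewrite !inE; have [->|fe] := eqVneq f e; first by rewrite eE capvSl.
by case: (boolP (f \in E)) => //= fE; rewrite cap_hyperplane_eq.
Qed.

(* Each codimension-2 subspace W contributes its flip to the power mult(W) - 1. *)
Lemma even_chamber_sign e x y : e \in E -> x \in Hyp e -> y \in Hyp e ->
  (forall f, f \in others E e -> dot f x != 0) ->
  (forall f, f \in others E e -> dot f y != 0) ->
  chamber_sign dot (Hyp e) (even_restricted dot E e)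
    (region dot (Hyp e) (even_others e) x) (region dot (Hyp e) (even_others e) y) =
  (\prod_(f <- others E e) (Num.sg (dot f x) * Num.sg (dot f y)))%:C%C.
Proof.
move=> eE xe ye xs ys; rewrite chamber_signE; congr (_%:C)%C.
have evS f : f \in even_others e -> f \in others E e.
  by rewrite mem_even_others mem_others => /and3P[-> _ ->].
have HW f z : z \in Hyp e -> (z \notin (Hyp e :&: Hyp f)%VS) = (dot f z != 0).
  exact: cap_notin.
pose d := flip (Hyp e) (region dot (Hyp e) (others E e) x) (region dot (Hyp e) (others E e) y).
have dE f : f \in others E e -> d (Hyp e :&: Hyp f)%VS = Num.sg (dot f x) * Num.sg (dot f y).
  by move=> fs; apply: flipE => // z; exact: HW.
(* The flips on the left are between regions of [even_others], those in [d] between the smaller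
   regions of [others]; both are the product of the signs of a normal f at x and at y. *)
transitivity (\prod_(W <- even_restricted dot E e) d W).
  rewrite big_seq [RHS]big_seq; apply: eq_bigr => _ /imfsetP[f /= + ->].
  rewrite inE => /and3P[fE fe fo].
  have fev : f \in even_others e by rewrite mem_even_others fe fo.
  rewrite dE ?evS// (@flipE _ _ (even_others e) f)//.
  - by move=> z; exact: HW.
  - by move=> g /evS; exact: xs.
  - by move=> g /evS; exact: ys.
pose S := [fset f in E | f != e]%fset.
have -> : \prod_(f <- others E e) (Num.sg (dot f x) * Num.sg (dot f y)) =
    \prod_(f <- S) d (Hyp e :&: Hyp f)%VS.
  rewrite /S big_fset/= -[RHS]big_filter -/(others E e).
  by rewrite big_seq [RHS]big_seq; apply: eq_bigr => f /dE.
rewrite (partition_big_imfset _ (fun f => Hyp e :&: Hyp f)%VS)/=.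
rewrite [RHS](eq_big_seq (fun W => if ~~ odd (multiplicity dot E W) then d W else 1)); last first.
  move=> _ /imfsetP[g /= + ->]; rewrite !inE => /andP[gE ge].
  rewrite (eq_bigr (fun=> d (Hyp e :&: Hyp g)%VS)); last by move=> f /eqP ->.
  rewrite big_fset_condE big_const_seq count_predT iter_mulr_1 multiplicityE//= negbK.
  have [->|->] : d (Hyp e :&: Hyp g)%VS = 1 \/ d (Hyp e :&: Hyp g)%VS = -1.
    by rewrite /d /flip; case: ifP => _; [right|left].
  - by rewrite expr1n if_same.
  - by rewrite -signr_odd; case: odd.
rewrite -[RHS]big_mkcond [RHS]big_fset_condE; apply: eq_fbig => // W; apply/idP/idP.
  move=> /imfsetP[f /=]; rewrite inE => /and3P[fE fe fo] ->; rewrite !inE/= fo andbT.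
  by apply/imfsetP; exists f => //=; rewrite !inE fE.
rewrite !inE/= => /andP[/imfsetP[f /= + ->] fo]; rewrite !inE => /andP[fE fe].
by apply/imfsetP; exists f => //=; rewrite inE fE fe.
Qed.

End Signs.

(** * Faces as sign vectors, the composition F o v, and the facets of a chamber *)

Section Faces.
Context {R : realType} {V : vectType R}.
Variables (dot : {dot V for idfun}) (E : {fset V}).
Hypothesis E_unit : forall e, e \in E -> dot e e = 1.
Hypothesis E_indep : forall e f, e \in E -> f \in E -> e != f -> free [:: e; f].
Implicit Types (X H W : {vspace V}) (e f u v w x y z : V) (F G U Z : set V).
Local Notation Hyp := (hyperplane dot).

(** The face through x: the partition of E that defines a face is read off from the signs of any of
    its points. *)
Definition cell x : set V :=
  [set y | forall f, f \in E -> Num.sg (dot f y) = Num.sg (dot f x)].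

Lemma cell_refl x : cell x x. Proof. by []. Qed.

Lemma cell_eq x y : cell x y -> cell y = cell x.
Proof.
by move=> xy; apply/seteqP; split => z H f fE; rewrite (H f fE) (xy f fE).
Qed.

Lemma faces_cell x : faces dot E (cell x).
Proof.
split; first by exists x.
exists [fset f in E | dot f x == 0]%fset, [fset f in E | 0 < dot f x]%fset,
  [fset f in E | dot f x < 0]%fset; split.
- apply/fsetP => f; rewrite !inE -!andb_orr; case: (f \in E) => //=.
  by case: (ltgtP (dot f x) 0).
- split; apply/fdisjointP => f; rewrite !inE => /andP[_ H]; rewrite negb_and.
  + by rewrite (eqP H) ltxx orbT.
  + by rewrite (eqP H) ltxx orbT.
  + by rewrite -leNgt (ltW H) orbT.
- apply/seteqP; split => y.
    move=> H; split => f; rewrite !inE => /andP[fE fx]; have := H f fE.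
    + by rewrite (eqP fx) sgr0 => /eqP; rewrite sgr_eq0 => /eqP.
    + by rewrite (gtr0_sg fx) => /eqP; rewrite sgr_cp0.
    + by rewrite (ltr0_sg fx) => /eqP; rewrite sgr_cp0.
  move=> [H0 Hp Hn] f fE; case: (ltgtP (dot f x) 0) => fx.
  + by rewrite (ltr0_sg fx) ltr0_sg// Hn// !inE fE.
  + by rewrite (gtr0_sg fx) gtr0_sg// Hp// !inE fE.
  + by rewrite fx H0// !inE fE fx eqxx.
Qed.

Lemma facesP F x : faces dot E F -> F x -> F = cell x.
Proof.
move=> [_ [E0 [Ep [En [EE _ ->]]]]] [x0 xp xn]; apply/seteqP; split => y.
  move=> [y0 yp yn] f; rewrite -EE !inE => /orP[/orP[]|] fE.
  + by rewrite x0// y0.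
  + by rewrite !gtr0_sg ?xp ?yp.
  + by rewrite !ltr0_sg ?xn ?yn.
move=> H; have sub f : f \in E0 \/ f \in Ep \/ f \in En -> f \in E.
  by rewrite -EE !inE => -[->|[->|->]]; rewrite ?orbT.
split => f fE; have := H f (sub f _).
+ by rewrite x0// sgr0 => /(_ (or_introl fE))/eqP; rewrite sgr_eq0 => /eqP.
+ rewrite (gtr0_sg (xp f fE)) => /(_ (or_intror (or_introl fE)))/eqP.
  by rewrite sgr_cp0.
+ rewrite (ltr0_sg (xn f fE)) => /(_ (or_intror (or_intror fE)))/eqP.
  by rewrite sgr_cp0.
Qed.

Lemma region_full_cell z : (forall f, f \in E -> dot f z != 0) ->
  region dot fullv E z = cell z.
Proof.
move=> zE; apply/seteqP; split => y.
  by move=> zy f fE; rewrite (region_sg zy fE).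
by move=> H; split => [|f fE]; rewrite ?memvf// mulr_gt0_sg zE//= H.
Qed.

Lemma region_facet_cell e u y : e \in E -> region dot (Hyp e) (others E e) u y ->
  region dot (Hyp e) (others E e) u = cell y.
Proof.
move=> eE uy; have [ye _] := uy; apply/seteqP; split => z.
  move=> uz f fE; have [ze _] := uz; have [->|fe] := eqVneq f e.
    by move: ye ze; rewrite !mem_hyperplane => /eqP -> /eqP ->.
  have fs : f \in others E e by rewrite mem_others fe.
  by rewrite -(region_sg uy fs) -(region_sg uz fs).
move=> H; split.
  have := H e eE; move: ye; rewrite !mem_hyperplane => /eqP ->.
  by rewrite sgr0 => /eqP; rewrite sgr_eq0.
move=> f fs; have [fu fy] := region_neq0 uy fs.
rewrite mulr_gt0_sg fu/= (region_sg uy fs) H//.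
by move: fs; rewrite mem_others => /andP[].
Qed.

(** Moving from H_e a small eps along e makes (e, .) equal to eps and keeps all other signs. So U o
    e is the chamber next to U on the positive side of H_e. *)
Lemma face_comp_facet e u y : e \in E -> region dot (Hyp e) (others E e) u y ->
  exists z, [/\ forall f, f \in E -> dot f z != 0,
    forall f, f \in others E e -> Num.sg (dot f z) = Num.sg (dot f u),
    0 < dot e z &
    face_comp dot E (region dot (Hyp e) (others E e) u) e = region dot fullv E z].
Proof.
move=> eE uy; set U := region _ _ _ _.
have [ye _] := uy.
have dote x (eps : R) : x \in Hyp e -> dot e (x + eps *: e) = eps.
  by rewrite mem_hyperplane linearDr/= dotZr E_unit// mulr1 => /eqP ->; rewrite add0r.
have ev x : U x -> \forall eps \near (0 : R)^'+, 0 < eps /\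
    forall f, f \in others E e -> Num.sg (dot f (x + eps *: e)) = Num.sg (dot f u).
  move=> ux; apply: filterS2 (nbhs_right_gt 0) (near_same_sign dot (others E e) x e).
  move=> eps eps_gt0 H; split => // f fs; have [fu fx] := region_neq0 ux fs.
  by rewrite (region_sg ux fs); have := H f fs fx; rewrite mulr_gt0_sg => /andP[_ /eqP].
have [eps0 [eps0_gt0 sgz]] := filter_ex (ev y uy).
pose z := y + eps0 *: e.
have ze : 0 < dot e z by rewrite dote.
have zE f : f \in E -> dot f z != 0.
  move=> fE; have [->|fe] := eqVneq f e; first by rewrite gt_eqF.
  have fs : f \in others E e by rewrite mem_others fe.
  have [fu _] := region_neq0 uy fs.
  by have := sgz f fs; rewrite -/z => /eqP; apply: contraTneq => ->; rewrite sgr0 eq_sym sgr_eq0.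
exists z; split => //; rewrite region_full_cell//.
have Gz x : U x -> \forall eps \near (0 : R)^'+, cell z (x + eps *: e).
  move=> ux; have [xe _] := ux; apply: filterS (ev x ux) => eps [eps_gt0 H] f fE.
  have [->|fe] := eqVneq f e; first by rewrite dote// !gtr0_sg.
  by have fs : f \in others E e; rewrite ?mem_others ?fe// H// -sgz.
(* The chosen face and [cell z] both contain y + eps e for small eps, and faces with a common point
   coincide. *)
rewrite /face_comp; case: xgetP => [G _ [fG HG]|H].
  have [eps [H1 H2]] := filter_ex (filterI (HG y uy) (Gz y uy)).
  by rewrite (facesP fG H1) (cell_eq H2).
by exfalso; apply: (H (cell z)); split => //; exact: faces_cell.
Qed.

(** A face is open in the intersection of the hyperplanes that contain it: y + eps v is still in the
    face, so v is a multiple of a difference of two of its points. *)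
Lemma cell_span y W : (forall x, cell y x -> x \in W) ->
  forall v, (forall f, f \in E -> dot f y = 0 -> dot f v = 0) -> v \in W.
Proof.
move=> yW v Hv.
have : \forall eps \near (0 : R)^'+, 0 < eps /\ cell y (y + eps *: v).
  apply: filterS2 (nbhs_right_gt 0) (near_same_sign dot E y v) => eps eps_gt0 H.
  split => // f fE; have [fy|fy] := eqVneq (dot f y) 0.
    by rewrite linearDr/= dotZr fy (Hv f fE fy) mulr0 addr0.
  by have := H f fE fy; rewrite mulr_gt0_sg => /andP[_ /eqP ->].
move=> /filter_ex[eps [eps_gt0 /yW yv]].
have := memvZ eps^-1 (memvB yv (yW y (cell_refl y))).
by rewrite addrAC subrr add0r scalerA mulVf ?gt_eqF// scale1r.
Qed.

Lemma closure_region_ge0 x y f : f \in E ->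
  closure (region dot fullv E x : set (euclidean dot)) y -> 0 <= dot f x * dot f y.
Proof.
move=> fE cy; rewrite leNgt; apply/negP => xy.
pose g (z : euclidean dot) : R := dot (dot f x *: f) z.
have gy : g y < 0 by rewrite /g dotZl.
have : nbhs (y : euclidean dot) (g @^-1` [set r | r < 0]).
  apply: (@continuous_dot R V dot (dot f x *: f) y).
  by apply: open_nbhs_nbhs; split => //; exact: open_lt.
by move=> /cy[z [[_ /(_ f fE)]]] /=; rewrite /g dotZl => /ltW; rewrite leNgt => /negP.
Qed.

Lemma closure_region x y e : e \in E -> (forall f, f \in E -> dot f x != 0) ->
  region dot (Hyp e) (others E e) x y ->
  closure (region dot fullv E x : set (euclidean dot)) y.
Proof.
move=> eE xE [ye yP] B By.
(* Moving in the direction x leads into the region: it adds eps (f, x)^2 > 0 to every product (f,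
   x)(f, y), which is positive for f other than e and zero for e. *)
pose g (t : R) : euclidean dot := (y : euclidean dot) + t *: (x : euclidean dot).
have cg : continuous g.
  move=> t; apply: cvgD; first exact: cvg_cst.
  by apply: cvgZr_tmp; exact: cvg_id.
have : \forall eps \near (0 : R)^'+, 0 < eps /\ B (g eps).
  have nB : nbhs (g 0) B by rewrite /g scale0r addr0.
  exact: filterS2 (nbhs_right_gt 0) (cvg_at_right_filter (cg 0) nB) => eps.
move=> /filter_ex[eps [eps_gt0 Bg]]; exists (g eps); split => //.
split => [|f fE]; first exact: memvf.
have fxx : 0 < eps * (dot f x * dot f x) by rewrite mulr_gt0// -expr2 exprn_even_gt0//= xE.
rewrite /g linearDr/= dotZr mulrDr [_ * (eps * _)]mulrCA.
have [->|fe] := eqVneq f e.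
  by move: ye fxx; rewrite mem_hyperplane => /eqP ->; rewrite mulr0 add0r => H;
    rewrite mulr_gt0// -expr2 exprn_even_gt0//= xE.
by rewrite addr_gt0// yP// mem_others fe.
Qed.

Lemma facet_normalE e u y : e \in E -> region dot (Hyp e) (others E e) u y ->
  facet_normal dot E (region dot (Hyp e) (others E e) u) = e.
Proof.
move=> eE uy; rewrite /facet_normal; case: xgetP => [e' _ [e'E H]|H].
  have [//|ee'] := eqVneq e' e.
  have [|_] := @region_neq0 _ _ _ _ _ _ _ uy e'; first by rewrite mem_others ee'.
  by have := H y uy; rewrite mem_hyperplane => ->.
by exfalso; apply: (H e); split => // x [].
Qed.

(** A point y of a facet lies on some H_e, since otherwise the face would span V, and on no second
    one, since otherwise its span would have codimension at least 2. Its remaining signs are those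
    of x because y is in the closure of the chamber. *)
Lemma facetsE x : (forall f, f \in E -> dot f x != 0) ->
  facets dot E (region dot fullv E x) =
  [set region dot (Hyp e) (others E e) x | e in
     [set e | e \in E /\ region dot (Hyp e) (others E e) x !=set0]].
Proof.
move=> xE; apply/seteqP; split => [U [fU [d dV [W [UW Wmin dW]]] Ucl]|_ [e [eE [y xy]] <-]].
  have [y Uy] := fU.1; have UE := facesP fU Uy.
  have span v : (forall f, f \in E -> dot f y = 0 -> dot f v = 0) -> v \in W.
    by apply: cell_span; rewrite -UE.
  have [e eE ye] : exists2 e, e \in E & dot e y = 0.
    apply: contrapT => H; have : (fullv <= W)%VS.
      apply/subvP => v _; apply: span => f fE fy; exfalso; apply: H; by exists f.
    by move=> /dimvS; rewrite dW -dV ltnn.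
  have yN f : f \in others E e -> dot f y != 0.
    rewrite mem_others => /andP[fe fE]; apply/eqP => fy.
    have UH g : g \in E -> dot g y = 0 -> forall z, U z -> z \in Hyp g.
      move=> gE gy z; rewrite UE => /(_ g gE); rewrite gy sgr0 mem_hyperplane.
      by move=> /eqP; rewrite sgr_eq0.
    have : (W <= Hyp e :&: Hyp f)%VS.
      by apply: Wmin => z Uz; rewrite memv_cap (UH e)// (UH f).
    move=> /dimvS; rewrite (dim_cap_hyperplane E_unit E_indep)// 1?eq_sym// dW.
    have := dim_hyperplane (E_unit eE); rewrite -dV => -[->].
    have [|v [ve vf _]] := @hyperplane_witness R V dot E E_unit E_indep e f eE fE.
      by rewrite eq_sym.
    (* The predecessor is truncated at 0, so in dimension 0 the inequality is no contradiction; but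
       then H_e = 0 cannot contain a vector v outside H_f. *)
    case E0 : (\dim (Hyp e)) => [|k]; last by rewrite ltnn.
    move/eqP: E0; rewrite dimv_eq0 => /eqP E0; move: ve vf; rewrite E0 memv0 => /eqP ->.
    by rewrite mem0v.
  have xy : region dot (Hyp e) (others E e) x y.
    split; first by rewrite mem_hyperplane ye.
    move=> f fs; have fE : f \in E by move: fs; rewrite mem_others => /andP[].
    rewrite lt_neqAle eq_sym mulf_neq0 ?xE ?yN//=.
    exact: closure_region_ge0 fE (Ucl y Uy).
  exists e; first by split => //; exists y.
  by rewrite UE (region_facet_cell eE xy).
split.
- by rewrite (region_facet_cell eE xy); exact: faces_cell.
- exists (\dim (Hyp e)); first by rewrite (dim_hyperplane (E_unit eE)).
  exists (Hyp e); split => // [z []//|W' HW'].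
  apply/subvP => v ve; apply: (@cell_span y W').
    by rewrite -(region_facet_cell eE xy).
  move=> f fE fy; have [->|fe] := eqVneq f e.
    by apply/eqP; rewrite -mem_hyperplane.
  have [|_] := @region_neq0 _ _ _ _ _ _ _ xy f; first by rewrite mem_others fe.
  by rewrite fy eqxx.
- by move=> z xz; exact: closure_region xz.
Qed.

Lemma facet_region_inj x : set_inj
  [set e | e \in E /\ region dot (Hyp e) (others E e) x !=set0]
  (fun e => region dot (Hyp e) (others E e) x).
Proof.
move=> e f /set_mem[eE [y ey]] /set_mem[fE _] ef.
have [//|nef] := eqVneq e f.
have := ey; rewrite ef => -[]; rewrite mem_hyperplane => /eqP fy _.
have [|_] := @region_neq0 _ _ _ _ _ _ _ ey f; first by rewrite mem_others eq_sym nef.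
by rewrite fy eqxx.
Qed.

End Faces.

(** * The flux identity for integrable f, and alternating sums over chambers as single integrals *)

Section Flux.
Context {R : realType} {V : vectType R}.
Variable dot : {dot V for idfun}.
Local Notation Rm := (measurableTypeR R).
Local Notation leb := (@lebesgue_measure R).
Local Notation mu X := (@lebesgue_tuple R (\dim X)).
Local Notation mV := (@lebesgue_tuple R (\dim {:V})).
Local Notation oV := (@of_coord R V dot fullv).
Local Notation Hyp := (hyperplane dot).
Implicit Types (X : {vspace V}) (AA : {fset {vspace V}}) (Z : set V).
Implicit Types (a u v x y e : V) (f F p q : V -> R) (s : seq V).

(** A substitution moves the shift by a from f to the step product. It is carried out for the Borel
    representative F, after which f is put back on V and on almost every slice. *)
Lemma stepprod_flux s p q f F a : uniq s -> (forall e, e \in s -> dot e e = 1) ->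
  (forall e e', e \in s -> e' \in s -> e != e' -> free [:: e; e']) ->
  (forall e, `|p e| <= 1) -> (forall e, `|q e| <= 1) ->
  mV.-integrable setT (EFin \o (F \o oV)) ->
  {ae mV, forall c, f (oV c) = F (oV c)} ->
  \int[mV]_c (f (oV c - a) * stepprod dot s p q (oV c)) -
  \int[mV]_c (f (oV c) * stepprod dot s p q (oV c)) =
  \sum_(e <- s) (p e - q e) * dot a e * \int[leb]_(t in `[0, 1])
     \int[mu (Hyp e)]_c (f (of_coord dot c - (t : R) *: a)
                         * stepprod dot (others s e) p q (of_coord dot c)).
Proof.
move=> us s1 sfree p1 q1 Fi fF.
have msp : measurable_fun setT (fun c => stepprod dot s p q (oV c)).
  by apply: measurable_stepprod => v; exact: measurable_dot_of_coord.
have mspa : measurable_fun setT (fun c => stepprod dot s p q (oV c + a)).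
  apply: measurable_stepprod => v.
  rewrite (_ : (fun c => _) = fun c => dot v (oV c) + dot v a).
    apply: measurable_realfun.measurable_funD => //; exact: measurable_dot_of_coord.
  by apply/funext => c; rewrite linearDr.
have bsp x : `|stepprod dot s p q x| <= 1 by exact: normr_stepprod.
have Fspi : mV.-integrable setT (EFin \o (fun c => F (oV c) * stepprod dot s p q (oV c))).
  exact: (integrable_bounded msp (fun c => bsp _) Fi).
have Fspai : mV.-integrable setT
    (EFin \o ((fun x => F x * stepprod dot s p q (x + a)) \o oV)).
  exact: (integrable_bounded mspa (fun c => bsp _) Fi).
have -> : \int[mV]_c (f (oV c) * stepprod dot s p q (oV c)) =
    \int[mV]_c (F (oV c) * stepprod dot s p q (oV c)).
  by apply: Rintegral_ae; apply: filterS fF => c -> _.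
have -> : \int[mV]_c (f (oV c - a) * stepprod dot s p q (oV c)) =
    \int[mV]_c (F (oV c) * stepprod dot s p q (oV c + a)).
  rewrite -(Rintegral_translate a Fspai); apply: Rintegral_ae.
  apply: filterS (ae_translate a (P := fun x => f x = F x) fF) => c /= -> _.
  by rewrite subrK.
rewrite -RintegralB//.
under eq_Rintegral do rewrite -mulrBr.
rewrite (Rintegral_stepprodB a us s1 sfree p1 q1 Fi) big_seq [RHS]big_seq; apply: eq_bigr => e es.
(* If (a, e) = 0, every slice is H_e itself, where f and F may be unrelated; the factor (a, e)
   disposes of the term. *)
have [ae|ae] := eqVneq (dot a e) 0; first by rewrite ae mulr0 !mul0r.
congr (_ * _).
have [N [mN N0 sN]] := ae_sweep (s1 e es) ae (P := fun x => f x = F x) fF.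
apply: (Rintegral_eq_off_null mN N0) => t _ Nt.
have fFt : {ae mu (Hyp e), forall c,
    f (of_coord dot c - (t : R) *: a) = F (of_coord dot c - (t : R) *: a)}.
  by apply: contrapT => H; apply/Nt/sN.
by apply: Rintegral_ae; apply: filterS fFt => c -> _.
Qed.

(** With [signed_neg], the choice of p and q for which [stepprod] is the indicator of the region of
    x; the jump p e - q e is then the sign of (e, x). *)
Definition signed_pos x (e : V) : R := (0 < dot e x)%R%:R.
Definition signed_neg x (e : V) : R := (dot e x < 0)%R%:R.

Lemma normr_signed_pos x e : `|signed_pos x e| <= 1.
Proof. by rewrite /signed_pos normr_nat lern1 leq_b1. Qed.

Lemma normr_signed_neg x e : `|signed_neg x e| <= 1.
Proof. by rewrite /signed_neg normr_nat lern1 leq_b1. Qed.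

Lemma signed_posB x e : signed_pos x e - signed_neg x e = Num.sg (dot e x).
Proof.
rewrite /signed_pos /signed_neg; case: (ltgtP (dot e x) 0) => [h|h|->].
- by rewrite ltr0_sg// sub0r.
- by rewrite gtr0_sg// subr0.
- by rewrite sgr0 subrr.
Qed.

Lemma stepprod_signed s x y : stepprod dot s (signed_pos x) (signed_neg x) y =
  (all (fun e : V => 0 < dot e x * dot e y)%R s)%:R.
Proof.
rewrite /stepprod; elim: s => [|f s IH]; first by rewrite big_nil.
rewrite big_cons IH /= -mulnb natrM; congr (_ * _).
rewrite /step /signed_pos /signed_neg mulr_gt0_sg.
case: (ltgtP (dot f y) 0) => [h|h|->].
- rewrite (ltr0_sg h) sgr_cp0; case: (ltgtP (dot f x) 0) => //.
- by rewrite (gtr0_sg h) sgr_cp0; case: (ltgtP (dot f x) 0).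
- by rewrite sgr0 sgr_eq0 andNb.
Qed.

Definition real_integral X Z f : R :=
  \int[mu X]_(c in @of_coord R V dot X @^-1` Z) f (of_coord dot c).

Lemma of_coord_mem X c : @of_coord R V dot X c \in X.
Proof. exact: lincomb_mem (onbasisP dot X). Qed.

Lemma real_integral_region X s x f : real_integral X (region dot X s x) f =
  \int[mu X]_c (f (of_coord dot c)
                * stepprod dot s (signed_pos x) (signed_neg x) (of_coord dot c)).
Proof.
rewrite /real_integral Rintegral_mkcond; apply: eq_Rintegral => c _.
rewrite patchE stepprod_signed; case: ifPn; rewrite ?inE ?notin_setE /preimage/=.
  by move=> [_ H]; rewrite (_ : all _ _) ?mulr1//; apply/allP.
move=> H; rewrite (_ : all _ _ = false) ?mulr0//; apply/negP => /allP H'; apply: H.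
by split => //; exact: of_coord_mem.
Qed.

Lemma region_flux s x f F a : uniq s -> (forall e, e \in s -> dot e e = 1) ->
  (forall e e', e \in s -> e' \in s -> e != e' -> free [:: e; e']) ->
  mV.-integrable setT (EFin \o (F \o oV)) ->
  {ae mV, forall c, f (oV c) = F (oV c)} ->
  real_integral fullv (region dot fullv s x) (fun y => f (y - a))
  - real_integral fullv (region dot fullv s x) f =
  \sum_(e <- s) Num.sg (dot e x) * dot a e * \int[leb]_(t in `[0, 1])
     real_integral (Hyp e) (region dot (Hyp e) (others s e) x)
       (fun y => f (y - (t : R) *: a)).
Proof.
move=> us s1 sfree Fi fF; rewrite !real_integral_region.
rewrite (stepprod_flux a us s1 sfree _ _ Fi fF); last 2 first.
- exact: normr_signed_pos.
- exact: normr_signed_neg.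
apply: eq_bigr => e _; rewrite signed_posB; congr (_ * _).
by apply: eq_Rintegral => t _; rewrite real_integral_region.
Qed.

Definition real_alt_integral X AA (sign : set V -> R) f : R :=
  \sum_(Z \in chambers dot X AA) sign Z * real_integral X Z f.

Lemma chambers_indicator X AA s (sign : set V -> R) x : presents dot X AA s -> x \in X ->
  (forall g, g \in s -> dot g x != 0) ->
  \sum_(Z <- fset_set (chambers dot X AA)) sign Z * (`[< Z x >])%:R =
  sign (region dot X s x).
Proof.
move=> ps xX xs; have fC := finite_chambers ps.
have Cx : chambers dot X AA (region dot X s x).
  by apply/(chambersP _ ps); exists x.
rewrite (big_fsetD1 (region dot X s x))/=; last by rewrite in_fset_set// inE.
rewrite (_ : `[< _ >] = true) ?mulr1; last exact/asboolP/region_refl.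
rewrite big_seq big1 ?addr0// => Z; rewrite !inE => /andP[ZN].
rewrite in_fset_set// inE => /(chambersP _ ps)[z [zX zs ZE]].
rewrite (_ : `[< _ >] = false) ?mulr0//; apply/asboolP => Zx.
by move: ZN; rewrite ZE in Zx *; rewrite (region_eq zX Zx) eqxx.
Qed.

(** Almost every point lies in exactly one chamber, so the alternating sum integrates f against the
    sign of that chamber. The list [l] is separate from [s], and [k] is free, because on H_e the
    chambers are cut out by [even_others] while their sign is a constant times a product over
    [others]. *)
Lemma real_alt_integralE X AA s (sign : set V -> R) (k : R) p q l f F :
  presents dot X AA s -> (forall e, `|p e| <= 1) -> (forall e, `|q e| <= 1) ->
  (mu X).-integrable setT (EFin \o (F \o @of_coord R V dot X)) ->
  {ae mu X, forall c, f (@of_coord R V dot X c) = F (of_coord dot c)} ->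
  {ae mu X, forall c, (forall g, g \in s -> dot g (@of_coord R V dot X c) != 0) /\
     sign (region dot X s (of_coord dot c)) = k * stepprod dot l p q (of_coord dot c)} ->
  real_alt_integral X AA sign f =
  k * \int[mu X]_c (f (of_coord dot c) * stepprod dot l p q (of_coord dot c)).
Proof.
move=> ps p1 q1 Fi fF signE; have fC := finite_chambers ps.
pose o := @of_coord R V dot X.
have msp l' p' q' : measurable_fun setT (fun c => stepprod dot l' p' q' (o c)).
  by apply: measurable_stepprod => v; exact: measurable_dot_of_coord.
have -> : \int[mu X]_c (f (o c) * stepprod dot l p q (o c)) =
    \int[mu X]_c (F (o c) * stepprod dot l p q (o c)).
  by apply: Rintegral_ae; apply: filterS fF => c -> _.
rewrite -RintegralZl//; last first.
  exact: (integrable_bounded (msp l p q) (fun c => normr_stepprod dot l _ p1 q1) Fi).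
rewrite /real_alt_integral fsbig_finite//.
(* Including the condition that Z is a chamber makes [G Z] integrable for every set Z, as
   [Rintegral_sum] asks. *)
pose G Z c := sign Z * (F (o c) * (`[< chambers dot X AA Z /\ Z (o c) >])%:R).
have indE Z : chambers dot X AA Z -> exists x, forall c,
    (`[< Z (o c) >])%:R = stepprod dot s (signed_pos x) (signed_neg x) (o c).
  move=> /(chambersP _ ps)[x [xX xs ->]]; exists x => c; rewrite stepprod_signed.
  congr (_%:R); congr nat_of_bool; apply/asboolP/allP => [[]//|H].
  by split => //; exact: of_coord_mem.
have Gi0 Z : (mu X).-integrable setT
    (EFin \o (fun c => F (o c) * (`[< chambers dot X AA Z /\ Z (o c) >])%:R)).
  apply: (@integrable_bounded _ _ _ _ _ _ 1) Fi => [|c]; last first.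
    by rewrite normr_nat lern1 leq_b1.
  have [CZ|NZ] := pselect (chambers dot X AA Z); last first.
    rewrite (_ : (fun c => _) = cst 0)//; apply/funext => c.
    by rewrite (_ : `[< _ >] = false)//; apply/asboolP => -[].
  have [x xE] := indE Z CZ; rewrite (_ : (fun c => _) = fun c =>
    stepprod dot s (signed_pos x) (signed_neg x) (o c)); first exact: msp.
  apply/funext => c; rewrite -xE; congr (_%:R); congr nat_of_bool.
  by apply/asboolP/asboolP => [[]|].
transitivity (\sum_(Z <- fset_set (chambers dot X AA)) \int[mu X]_c G Z c).
  rewrite big_seq [RHS]big_seq; apply: eq_bigr => Z; rewrite in_fset_set// inE => CZ.
  rewrite /G RintegralZl//; congr (_ * _); rewrite /real_integral Rintegral_mkcond.
  apply: Rintegral_ae; apply: filterS fF => c fFc _; rewrite patchE.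
  case: ifPn; rewrite ?inE ?notin_setE /preimage/= => Zc.
    by rewrite fFc (_ : `[< _ >] = true) ?mulr1//; apply/asboolP.
  by rewrite (_ : `[< _ >] = false) ?mulr0//; apply/asboolP => -[].
rewrite -Rintegral_sum//; last first.
  move=> Z; rewrite /G; have := integrableZl measurableT (sign Z) (Gi0 Z).
  by congr (_.-integrable _ _); apply/funext => c.
apply: Rintegral_ae; apply: filterS signE => c [cs signc] _.
rewrite mulrCA -signc -(chambers_indicator _ ps (of_coord_mem c) cs) mulr_sumr.
rewrite big_seq [RHS]big_seq; apply: eq_bigr => Z; rewrite in_fset_set// inE => CZ.
rewrite /G mulrCA; congr (_ * _); congr (_ * _%:R); congr nat_of_bool.
by apply/asboolP/asboolP => [[]|].
Qed.

End Flux.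

(** * Signs in front of integrals, and points obtained from almost everywhere statements *)

Section SignedIntegral.
Context {R : realType}.

Lemma RintegralN d (T : measurableType d) (mu : {measure set T -> \bar R})
    (D : set T) (f : T -> R) :
  \int[mu]_(x in D) (- f x) = - \int[mu]_(x in D) f x.
Proof.
rewrite /Rintegral integralE [in RHS]integralE.
rewrite (_ : (fun x => (- f x)%:E) = (\- (EFin \o f))%E)//.
rewrite funeposN funenegN.
set u := (\int[mu]_(x in D) _)%E; set v := (\int[mu]_(x in D) _)%E.
(* As soon as one of the two parts is infinite, [fine] sends both sides to 0. *)
by case: u v => [u| |] [v| |]; rewrite //= ?opprB ?oppr0.
Qed.

(** Restricting k to 1 and -1 lets the restricted sign pass through the t-integral in
    [even_alt_flux] without an integrability argument. *)
Lemma Rintegral_signZ d (T : measurableType d) (mu : {measure set T -> \bar R})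
    (D : set T) (k : R) (f : T -> R) : k ^+ 2 = 1 ->
  \int[mu]_(x in D) (k * f x) = k * \int[mu]_(x in D) f x.
Proof.
move=> /eqP; rewrite sqrf_eq1 => /orP[] /eqP ->.
  by rewrite mul1r; apply: eq_Rintegral => x _; rewrite mul1r.
by rewrite mulN1r -RintegralN; apply: eq_Rintegral => x _; rewrite mulN1r.
Qed.

Lemma ae_exists d (T : measurableType d) (mu : {measure set T -> \bar R})
    (A : set T) (P : T -> Prop) : measurable A -> (0 < mu A)%E ->
  {ae mu, forall x, P x} -> exists x, P x.
Proof.
move=> mA A0 [N [mN N0 sN]]; apply: contrapT => H.
have AN : A `<=` N by move=> x _; apply: sN => /= Px; apply: H; exists x.
by move: A0; rewrite (subset_measure0 mA mN AN N0) ltxx.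
Qed.

End SignedIntegral.

(** * Generic points of H_e, the signs of the two formulas, and the flux of the alternating
    integral *)

Section Assembly.
Context {R : realType} {V : vectType R}.
Variables (dot : {dot V for idfun}) (E : {fset V}).
Hypothesis E_unit : forall e, e \in E -> dot e e = 1.
Hypothesis E_indep : forall e f, e \in E -> f \in E -> e != f -> free [:: e; f].
Local Notation Rm := (measurableTypeR R).
Local Notation leb := (@lebesgue_measure R).
Local Notation mu X := (@lebesgue_tuple R (\dim X)).
Local Notation mV := (@lebesgue_tuple R (\dim {:V})).
Local Notation oV := (@of_coord R V dot fullv).
Local Notation Hyp := (hyperplane dot).
Implicit Types (X : {vspace V}) (AA : {fset {vspace V}}) (Z T U : set V).
Implicit Types (a u v w x y z e g h : V).

Lemma step_sgE (r : R) : step 1 (-1) r = Num.sg r.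
Proof.
by rewrite /step; case: (ltgtP r 0) => [h|h|->]; rewrite ?(ltr0_sg h) ?(gtr0_sg h) ?sgr0.
Qed.

Lemma stepprod_sgE (s : seq V) x :
  stepprod dot s (fun=> 1) (fun=> -1) x = \prod_(e <- s) Num.sg (dot e x).
Proof. by apply: eq_bigr => e _; rewrite step_sgE. Qed.

Lemma prod_sg_sqr (s : seq V) x : (forall f, f \in s -> dot f x != 0) ->
  (\prod_(f <- s) Num.sg (dot f x)) ^+ 2 = 1.
Proof.
move=> sx; rewrite -prodrXl big_seq big1// => f fs.
by rewrite sqr_sg sx.
Qed.

Lemma prod_others (F : V -> R) e : e \in E ->
  \prod_(f <- E) F f = F e * \prod_(f <- others E e) F f.
Proof.
by move=> eE; rewrite (bigD1_seq e)//= ?fset_uniq// /others big_filter.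
Qed.

(** H_e is null in V, so a generic point of V says nothing about it directly. But the projection v
    of f to H_e satisfies (v, y - t e) = (f, y) for y in H_e, so a single good slice of the sweep
    along e is enough. *)
Lemma ae_generic_hyperplane e : e \in E ->
  {ae mu (Hyp e), forall c, forall f, f \in others E e ->
     dot f (@of_coord R V dot (Hyp e) c) != 0}.
Proof.
move=> eE; have e1 := E_unit eE.
have one f : f \in others E e ->
    {ae mu (Hyp e), forall c, dot f (@of_coord R V dot (Hyp e) c) != 0}.
  rewrite mem_others => /andP[fe fE].
  have [|v [ve vf vE]] := hyperplane_witness E_unit E_indep eE fE; first by rewrite eq_sym.
  have v0 : v != 0 by apply: contraNneq vf => ->; exact: mem0v.
  have ee0 : dot e e != 0 by rewrite e1 oner_eq0.
  have [||t Ht] := @ae_exists R _ _ leb `[0, 1]%classic _ _ _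
    (ae_sweep e1 ee0 (P := fun x => dot v x != 0) (ae_neq_affine dot 0 v0)) => //.
    by rewrite [X in (_ < X)%E]lebesgue_measure_itv/= lte_fin ltr01 sube0 lte_fin.
  apply: filterS Ht => c; rewrite linearBr/= dotZr.
  have -> : dot v e = 0 by rewrite dotC; apply/eqP; rewrite -mem_hyperplane.
  rewrite mulr0 subr0 vE linearBl/= dotZl (_ : dot e _ = 0) ?mulr0 ?subr0//.
  by apply/eqP; rewrite -mem_hyperplane; exact: of_coord_mem.
elim: (others E e) one => [|f s IH] one; first by apply: filterE.
apply: filterS2 (one f (mem_head _ _)) (IH _) => [c cf cs g|g gs].
  by rewrite inE => /predU1P[->|/cs].
by apply: one; rewrite inE gs orbT.
Qed.

(** Pushing a point z of Z slightly in a generic direction w of H_e leaves all H_f other than H_e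
    without leaving Z, so Z contains a chamber of the restricted arrangement and [xget] returns a
    real one. Its composition with e is on the positive side of H_e, hence only the other signs
    enter. *)
Lemma even_chamber e x Z : e \in E -> (forall f, f \in E -> 0 < dot f x) ->
  chambers dot (Hyp e) (even_restricted dot E e) Z ->
  exists u, [/\ u \in Hyp e, forall f, f \in others E e -> dot f u != 0,
    Z = region dot (Hyp e) (even_others dot E e) u &
    restricted_sign dot E (region dot fullv E x) e Z =
      (\prod_(f <- others E e) Num.sg (dot f u))%:C%C].
Proof.
move=> eE x0 /(chambersP _ (@presents_even_restricted R V dot E e))[z [ze zev ZE]].
have evS f : f \in even_others dot E e -> f \in others E e.
  by rewrite mem_even_others mem_others => /and3P[-> _ ->].
have zZ : Z z by rewrite ZE; exact: region_refl.
have [w we wN] : exists2 w, w \in Hyp e & forall f, f \in others E e -> dot f w != 0.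
  have [B0 _] := lebesgue_tball (R := R) (\dim (Hyp e)).
  have [c Hc] := ae_exists (@measurable_tball R _) B0 (ae_generic_hyperplane eE).
  by exists (@of_coord R V dot (Hyp e) c) => //; exact: of_coord_mem.
have [eps [eps0 Heps]] := filter_ex (filterI (nbhs_right_gt (0 : R))
  (near_same_sign dot (others E e) z w)).
pose u0 := z + eps *: w.
have u0e : u0 \in Hyp e by rewrite memvD// memvZ.
have u0N f : f \in others E e -> dot f u0 != 0.
  move=> fs; have [fz|fz] := eqVneq (dot f z) 0.
    by rewrite linearDr/= dotZr fz add0r mulf_neq0 ?wN// gt_eqF.
  by have := Heps f fs fz; apply: contraTneq => ->; rewrite mulr0 ltxx.
have zu0 : region dot (Hyp e) (even_others dot E e) z u0.
  by split => // f fev; apply: Heps; [exact: evS|exact: zev].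
have CU0 : chambers dot (Hyp e) (restricted dot E e) (region dot (Hyp e) (others E e) u0).
  by apply/(chambersP _ (@presents_restricted R V dot E e)); exists u0.
have sub0 : region dot (Hyp e) (others E e) u0 `<=` Z.
  rewrite ZE (region_eq ze zu0) => y [ye yP]; split => // f fev.
  by apply: yP; exact: evS.
rewrite /restricted_sign; case: xgetP => [U _ [CU UZ]|H]; last first.
  by exfalso; apply: (H _); split; [exact: CU0|exact: sub0].
have [u [ue uN UE]] := (chambersP _ (@presents_restricted R V dot E e)).1 CU.
have uu : region dot (Hyp e) (others E e) u u by exact: region_refl.
exists u; split => //.
  by rewrite ZE; apply: region_eq => //; rewrite -ZE; apply: UZ; rewrite UE.
have [z' [z'N z'sg z'e ->]] : exists z', [/\ forall f, f \in E -> dot f z' != 0,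
    forall f, f \in others E e -> Num.sg (dot f z') = Num.sg (dot f u),
    0 < dot e z' & face_comp dot E U e = region dot fullv E z'].
  by rewrite UE; exact: face_comp_facet uu.
rewrite (base_signE E_unit E_indep x0 z'N) (prod_others _ eE) gtr0_sg// mul1r.
by congr (_%:C)%C; rewrite big_seq [RHS]big_seq; apply: eq_bigr.
Qed.

Definition chamber_rsign X AA Z0 Z : R := \prod_(H <- AA) flip dot X Z0 Z H.

(** The chamber sign relative to Z is k times the product of the signs of the other normals, where k
    is that product at a point u of Z, that is the restricted sign. The two factors k cancel, so the
    right-hand side does not involve Z. *)
Lemma even_alt_flux e x Z (f F : V -> R) a : e \in E ->
  (forall g, g \in E -> 0 < dot g x) ->
  chambers dot (Hyp e) (even_restricted dot E e) Z ->
  mV.-integrable setT (EFin \o (F \o oV)) ->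
  {ae mV, forall c, f (oV c) = F (oV c)} ->
  exists2 k : R, restricted_sign dot E (region dot fullv E x) e Z = k%:C%C &
  k * dot a e * \int[leb]_(t in `[0, 1])
    real_alt_integral dot (Hyp e) (even_restricted dot E e)
      (chamber_rsign (Hyp e) (even_restricted dot E e) Z)
      (fun y => f (y - (t : R) *: a)) =
  dot a e * \int[leb]_(t in `[0, 1])
    \int[mu (Hyp e)]_c (f (of_coord dot c - (t : R) *: a) *
      stepprod dot (others E e) (fun=> 1) (fun=> -1) (of_coord dot c)).
Proof.
move=> eE x0 CZ Fi fF; have e1 := E_unit eE.
have [u [ue uN ZE ->]] := even_chamber eE x0 CZ.
set k := \prod_(g <- _) _; exists k => //.
have k2 : k ^+ 2 = 1 by exact: prod_sg_sqr.
have [ae|ae] := eqVneq (dot a e) 0; first by rewrite ae mulr0 !mul0r.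
rewrite [k * _]mulrC -mulrA; congr (_ * _); rewrite -Rintegral_signZ//.
have [N [mN N0 sN]] := ae_sweep e1 ae (P := fun x => f x = F x) fF.
(* Two null sets of times t are discarded: [N], where f and F differ essentially on the slice, and
   [M], where F is not integrable on it. *)
have [M [mM M0 sM]] := ae_integrable1 (integrable_sweep e1 ae Fi).
apply: (@Rintegral_eq_off_null _ _ _ _ (N `|` M)).
- exact: measurableU.
- by rewrite measureU0.
move=> t _ NMt.
have fFt : {ae mu (Hyp e), forall c,
    f (of_coord dot c - (t : R) *: a) = F (of_coord dot c - (t : R) *: a)}.
  by apply: contrapT => H; apply: NMt; left; apply: sN.
have Fti : (mu (Hyp e)).-integrable setT
    (EFin \o ((fun y => F (y - (t : R) *: a)) \o @of_coord R V dot (Hyp e))).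
  by apply: contrapT => H; apply: NMt; right; apply: sM.
rewrite (@real_alt_integralE _ _ dot (Hyp e) (even_restricted dot E e)
  (even_others dot E e) _ k (fun=> 1) (fun=> -1) (others E e) _
  (fun y => F (y - (t : R) *: a)))//.
- by rewrite mulrA -expr2 k2 mul1r.
- exact: presents_even_restricted.
- by move=> g; rewrite normr1.
- by move=> g; rewrite normrN1.
apply: filterS (ae_generic_hyperplane eE) => c cN; split.
  move=> g; rewrite mem_even_others => /and3P[ge _ gE].
  by apply: cN; rewrite mem_others ge.
have := even_chamber_sign E_unit E_indep eE ue (of_coord_mem dot c) uN cN.
rewrite chamber_signE /chamber_rsign ZE => /complexI ->.
by rewrite big_split/= stepprod_sgE.
Qed.

Lemma arrangement_alt_flux x (f F : V -> R) a : (forall g, g \in E -> 0 < dot g x) ->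
  mV.-integrable setT (EFin \o (F \o oV)) ->
  {ae mV, forall c, f (oV c) = F (oV c)} ->
  let sign := chamber_rsign fullv (arrangement dot E) (region dot fullv E x) in
  real_alt_integral dot fullv (arrangement dot E) sign (fun y => f (y - a))
  - real_alt_integral dot fullv (arrangement dot E) sign f =
  2 * \sum_(e <- E) dot a e * \int[leb]_(t in `[0, 1])
    \int[mu (Hyp e)]_c (f (of_coord dot c - (t : R) *: a) *
      stepprod dot (others E e) (fun=> 1) (fun=> -1) (of_coord dot c)).
Proof.
move=> x0 Fi fF sign.
have ae_gen : {ae mV, forall c, (forall g, g \in (E : seq V) -> dot g (oV c) != 0) /\
    sign (region dot fullv E (oV c)) =
    1 * stepprod dot E (fun=> 1) (fun=> -1) (oV c)}.
  have H : {ae mV, forall c, forall g, g \in (E : seq V) -> dot g (oV c) != 0}.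
    have E0 g : g \in (E : seq V) -> g != 0.
      by move=> /E_unit g1; apply: contra_eq_neq g1 => ->; rewrite linear0r eq_sym oner_eq0.
    elim: (E : seq V) E0 => [|g s IH] s0; first by apply: filterE.
    apply: filterS2 (ae_neq_affine dot 0 (s0 g (mem_head _ _))) (IH _) => [c cg cs h|h hs].
      by rewrite inE => /predU1P[->|/cs].
    by apply: s0; rewrite inE hs orbT.
  apply: filterS H => c cN; split => //.
  have := base_signE E_unit E_indep x0 cN.
  by rewrite /base_sign chamber_signE => /complexI H; rewrite mul1r stepprod_sgE; exact: H.
have p1 : forall e, `|(fun=> 1 : R) e| <= 1 by move=> e; rewrite normr1.
have q1 : forall e, `|(fun=> -1 : R) e| <= 1 by move=> e; rewrite normrN1.
have ps := presents_arrangement dot E.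
rewrite (real_alt_integralE ps p1 q1 Fi fF ae_gen).
rewrite (@real_alt_integralE R V dot fullv (arrangement dot E) E sign 1
  (fun=> 1) (fun=> -1) E (fun y => f (y - a)) (fun y => F (y - a)) ps p1 q1
  (integrable_translate a Fi) (ae_translate a (P := fun x => f x = F x) fF) ae_gen).
rewrite !mul1r (stepprod_flux a (fset_uniq E) E_unit E_indep p1 q1 Fi fF).
(* The factor 2 is the jump 1 - (-1). *)
rewrite mulr_sumr; apply: eq_bigr => e _; rewrite mulrA; congr (_ * _ * _).
by rewrite opprK.
Qed.

Lemma complexZ (r u v : R) : (r%:C * Complex u v)%C = Complex (r * u) (r * v).
Proof. by apply/eqP; rewrite eq_complex/= !mul0r subr0 addr0 !eqxx. Qed.

Lemma complex_sum I (s : seq I) (A B : I -> R) :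
  \sum_(i <- s) Complex (A i) (B i) = Complex (\sum_(i <- s) A i) (\sum_(i <- s) B i).
Proof.
elim: s => [|i s IH]; first by rewrite !big_nil.
by rewrite !big_cons IH; apply/eqP; rewrite eq_complex/= !eqxx.
Qed.

Lemma alt_integralE X AA (s : seq V) Z0 (f : V -> R[i]) : presents dot X AA s ->
  alt_integral dot X AA Z0 f =
  Complex (real_alt_integral dot X AA (chamber_rsign X AA Z0) (@complex.Re R \o f))
    (real_alt_integral dot X AA (chamber_rsign X AA Z0) (@complex.Im R \o f)).
Proof.
move=> /finite_chambers fC; rewrite /alt_integral /real_alt_integral !fsbig_finite//.
rewrite -complex_sum; apply: eq_bigr => Z _.
by rewrite chamber_signE -complexZ.
Qed.

Lemma lebesgue_integrableP (f : V -> R[i]) : lebesgue_integrable dot f ->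
  (exists2 F : V -> R, mV.-integrable setT (EFin \o (F \o oV)) &
     {ae mV, forall c, complex.Re (f (oV c)) = F (oV c)}) /\
  (exists2 F : V -> R, mV.-integrable setT (EFin \o (F \o oV)) &
     {ae mV, forall c, complex.Im (f (oV c)) = F (oV c)}).
Proof.
move=> [g [gRe gIm] fg].
have gK c : g (coords dot (onbasis dot fullv) (oV c)) = g c.
  by rewrite [coords _ _ _](lincombK (onbasisP dot fullv)).
split; [exists (@complex.Re R \o g \o coords dot (onbasis dot fullv))
       |exists (@complex.Im R \o g \o coords dot (onbasis dot fullv))].
- by move: gRe; congr (_.-integrable _ _); apply/funext => c /=; rewrite gK.
- by apply: filterS fg => c /= ->; rewrite gK.
- by move: gIm; congr (_.-integrable _ _); apply/funext => c /=; rewrite gK.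
- by apply: filterS fg => c /= ->; rewrite gK.
Qed.

(** The chamber of x and U o e have the same sign at every normal except e, where U o e is positive;
    all the other signs are squared. *)
Lemma facet_signE x0 x e y : e \in E -> (forall f, f \in E -> 0 < dot f x0) ->
  (forall f, f \in E -> dot f x != 0) ->
  region dot (Hyp e) (others E e) x y ->
  let U := region dot (Hyp e) (others E e) x in
  base_sign dot E (region dot fullv E x0) (region dot fullv E x) *
  base_sign dot E (region dot fullv E x0) (face_comp dot E U (facet_normal dot E U)) =
  (Num.sg (dot e x))%:C%C.
Proof.
move=> eE x0P xE xy U; rewrite (facet_normalE eE xy).
have [z [zN zsg ze ->]] := face_comp_facet E_unit eE xy.
rewrite (base_signE E_unit E_indep x0P xE) (base_signE E_unit E_indep x0P zN).
rewrite -rmorphM/=; congr (_%:C)%C.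
rewrite !(prod_others _ eE) [Num.sg (dot e z)]gtr0_sg// mul1r -mulrA.
rewrite [X in _ * (_ * X)](_ : _ = \prod_(f <- others E e) Num.sg (dot f x)).
  rewrite -expr2 prod_sg_sqr ?mulr1// => f; rewrite mem_others => /andP[_]; exact: xE.
by rewrite big_seq [RHS]big_seq; apply: eq_bigr.
Qed.

End Assembly.

Local Open Scope complex_scope.

Theorem theorem3p4 (R : realType) (V : vectType R) (dot : {dot V for idfun})
    (E : {fset V}) (T0 : set V) (f : V -> R[i])
    (E_unit : forall e, e \in E -> dot e e = 1)
    (E_indep : forall e e', e \in E -> e' \in E -> e != e' -> free [:: e; e'])
    (T0_chamber : chambers dot fullv (arrangement dot E) T0)
    (T0_pos : forall e x, e \in E -> T0 x -> 0 < dot e x)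
    (f_int : lebesgue_integrable dot f) :
  (forall (T : set V) (a : V),
     chambers dot fullv (arrangement dot E) T ->
     subspace_integral dot fullv T (translate f a)
       - subspace_integral dot fullv T f
     = \sum_(U \in facets dot E T)
         base_sign dot E T0 T
         * base_sign dot E T0 (face_comp dot E U (facet_normal dot E U))
         * (dot a (facet_normal dot E U))%:C
         * cintegral lebesgue_measure `[0, 1]
             (fun t : measurableTypeR R =>
                subspace_integral dot (hyperplane dot (facet_normal dot E U)) U
                  (translate f ((t : R) *: a))))
  /\
  (forall Z0 : V -> set V,
     (forall e, e \in E ->
        chambers dot (hyperplane dot e) (even_restricted dot E e) (Z0 e)) ->
     forall a : V,
     alt_integral dot fullv (arrangement dot E) T0 (translate f a)
       - alt_integral dot fullv (arrangement dot E) T0 f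
     = 2 * \sum_(e <- E)
         restricted_sign dot E T0 e (Z0 e)
         * (dot a e)%:C
         * cintegral lebesgue_measure `[0, 1]
             (fun t : measurableTypeR R =>
                alt_integral dot (hyperplane dot e) (even_restricted dot E e)
                  (Z0 e) (translate f ((t : R) *: a)))).
Proof.
have ps := presents_arrangement dot E.
have [[F Fi fF] [G Gi fG]] := lebesgue_integrableP f_int.
have [x0 [_ x0N T0E]] := (chambersP _ ps).1 T0_chamber.
have x0P g : g \in E -> 0 < dot g x0.
  by move=> gE; apply: T0_pos => //; rewrite T0E; apply: region_refl => //; exact: memvf.
split=> [T a /(chambersP _ ps)[x [_ xN ->]]|Z0 Z0P a].
- rewrite (facetsE E_unit E_indep xN) fsbig_image; last exact: facet_region_inj.
  pose A (g : V -> R) e := Num.sg (dot e x) * dot a e *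
    \int[lebesgue_measure]_(t in `[0, 1]) real_integral dot (hyperplane dot e)
      (region dot (hyperplane dot e) (others E e) x) (fun y => g (y - (t : R) *: a)).
  transitivity (\sum_(e <- E) Complex (A (@complex.Re R \o f) e) (A (@complex.Im R \o f) e)).
    rewrite complex_sum.
    rewrite -(region_flux x a (fset_uniq E) E_unit E_indep Fi fF).
    by rewrite -(region_flux x a (fset_uniq E) E_unit E_indep Gi fG).
  pose P := [set e | e \in E /\ region dot (hyperplane dot e) (others E e) x !=set0].
  have -> : \sum_(e <- E) Complex (A (@complex.Re R \o f) e) (A (@complex.Im R \o f) e) =
      \sum_(e \in P) Complex (A (@complex.Re R \o f) e) (A (@complex.Im R \o f) e).
    (* The flux sum runs over all of E. A normal whose region in H_e is empty integrates over the
       empty set and contributes 0; the remaining normals index the facets. *)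
    rewrite fsbig_seq ?fset_uniq//; apply/esym/fsbig_widen => [e []//|].
    move=> e [/= eE H]; have U0 : region dot (hyperplane dot e) (others E e) x = set0.
      by apply/seteqP; split => // y xy; apply: H; split => //; exists y.
    rewrite /preimage/= /A U0; have A0 (g : V -> R) : \int[lebesgue_measure]_(t in `[0, 1])
        real_integral dot (hyperplane dot e) set0 (fun y => g (y - (t : R) *: a)) = 0.
      under eq_Rintegral do rewrite /real_integral preimage_set0 Rintegral_set0.
      by rewrite Rintegral_cst//= mul0r.
    by rewrite !A0 !mulr0.
  apply: eq_fsbigr => e /set_mem[eE [y xy]].
  rewrite T0E (facet_signE E_unit E_indep eE x0P xN xy) (facet_normalE eE xy).
  by rewrite -rmorphM/= /cintegral complexZ.
- rewrite !(alt_integralE _ _ ps).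
  pose A (g : V -> R) e := dot a e * \int[lebesgue_measure]_(t in `[0, 1])
    \int[@lebesgue_tuple R (\dim (hyperplane dot e))]_c
      (g (of_coord dot c - (t : R) *: a) *
       stepprod dot (others E e) (fun=> 1) (fun=> -1) (of_coord dot c)).
  transitivity (2%:C * \sum_(e <- E) Complex (A (@complex.Re R \o f) e) (A (@complex.Im R \o f) e)).
    rewrite complex_sum complexZ T0E.
    rewrite -(arrangement_alt_flux E_unit E_indep a x0P Fi fF).
    by rewrite -(arrangement_alt_flux E_unit E_indep a x0P Gi fG).
  rewrite GRing.rmorph_nat; congr (_ * _).
  rewrite big_seq [RHS]big_seq; apply: eq_bigr => e eE.
  have [k kE AE] := @even_alt_flux R V dot E E_unit E_indep e x0 (Z0 e)
    (@complex.Re R \o f) F a eE x0P (Z0P e eE) Fi fF.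
  have [k' k'E BE] := @even_alt_flux R V dot E E_unit E_indep e x0 (Z0 e)
    (@complex.Im R \o f) G a eE x0P (Z0P e eE) Gi fG.
  (* Real and imaginary part each come with the restricted sign as a real number; injectivity of the
     embedding of R identifies the two. *)
  have kk' : k' = k by apply: complexI; rewrite -kE -k'E.
  rewrite {}kk' in BE; rewrite T0E kE -rmorphM/=.
  rewrite (_ : (fun t => alt_integral _ _ _ _ _) = fun t : measurableTypeR R => Complex
    (real_alt_integral dot (hyperplane dot e) (even_restricted dot E e)
      (chamber_rsign dot (hyperplane dot e) (even_restricted dot E e) (Z0 e))
      (@complex.Re R \o translate f ((t : R) *: a)))
    (real_alt_integral dot (hyperplane dot e) (even_restricted dot E e)
      (chamber_rsign dot (hyperplane dot e) (even_restricted dot E e) (Z0 e))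
      (@complex.Im R \o translate f ((t : R) *: a)))); last first.
    apply/funext => t; exact: (alt_integralE _ _ (@presents_even_restricted R V dot E e)).
  by rewrite /cintegral complexZ /=; congr Complex; [exact: esym AE|exact: esym BE].
Qed.
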